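(* There exist universal constants $c_1,c_2>0$ such that the following holds. Let $n\ge2$ and $p\ge17$ be integers, let $X\in\mathbb{R}^{n\times p}$ have i.i.d. $\mathcal{N}(0,I_p)$ rows, let $S=n^{-1}X^{\mathsf T}X$, let $$\widehat\Theta=\operatorname{argmin}_{\Theta\in\mathcal{M}^{p\times p}}\{\langle\Theta,S\rangle-\log\det\Theta\},$$ and let $\widehat\Sigma=\widehat\Theta^{-1}$. Then $$\lambda_{\max}(\widehat\Sigma)\ge1+c_1\frac{p}{\sqrt n}$$ with probability at least $1-3p\exp(-c_2\min\{n,p\})$.
   Context: $\mathcal{M}^{p\times p}$ is the set of $p\times p$ symmetric positive semidefinite matrices $\Theta$ with $\Theta_{jk}\le 0$ for all $j\neq k$. $\langle A,B\rangle=\mathrm{tr}(A^{\mathsf T}B)$, and $-\log\det\Theta=+\infty$ for singular $\Theta$. For $n\ge 2$ the minimizer $\widehat\Theta$ exists, is unique and is nonsingular with probability one (a known fact). $\lambda_{\max}$ denotes the largest eigenvalue. *)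

(* Defs.v *)
From HB Require Import structures.
From mathcomp Require Import all_boot all_order all_algebra.
From mathcomp Require Import all_classical all_reals all_analysis.

Set Implicit Arguments.
Unset Strict Implicit.
Unset Printing Implicit Defensive.

Import Order.TTheory GRing.Theory Num.Theory.
Import numFieldNormedType.Exports.

Local Open Scope classical_set_scope.
Local Open Scope ring_scope.

Definition sym_psd (R : realType) (p : nat) (A : 'M[R]_p) : Prop :=
  A^T = A /\ forall x : 'cV[R]_p, 0 <= (x^T *m A *m x) 0 0.

Definition Mset (R : realType) (p : nat) : set 'M[R]_p :=
  [set Theta | sym_psd Theta /\ forall j k, j != k -> Theta j k <= 0].

Definition frob (R : realType) (p : nat) (A B : 'M[R]_p) : R := \tr (A^T *m B).

(* Only meant for positive semidefinite matrices, whose determinant is >= 0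
   ([ln] is 0 on negative numbers). *)
Definition neg_logdet (R : realType) (p : nat) (Theta : 'M[R]_p) : \bar R :=
  if \det Theta == 0 then +oo%E else (- ln (\det Theta))%:E.

Definition objective (R : realType) (p : nat) (S Theta : 'M[R]_p) : \bar R :=
  ((frob Theta S)%:E + neg_logdet Theta)%E.

Definition argmin_set (R : realType) (p : nat) (S : 'M[R]_p) : set 'M[R]_p :=
  [set Theta | Mset Theta /\
     forall Theta', Mset Theta' -> (objective S Theta <= objective S Theta')%E].

(* When there is no minimizer the default value is the zero matrix. Then
   [invmx 0 = 0] has largest eigenvalue 0, so that a positive lower bound on
   [lambda_max (Sigma_hat S)] fails when the minimizer does not exist. *)
Definition Theta_hat (R : realType) (p : nat) (S : 'M[R]_p) : 'M[R]_p :=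
  xget 0 (argmin_set S).

Definition Sigma_hat (R : realType) (p : nat) (S : 'M[R]_p) : 'M[R]_p :=
  invmx (Theta_hat S).

(* The set of eigenvalues is finite, so the supremum is attained as soon as
   there is a real eigenvalue, e.g., for a symmetric matrix of positive size. *)
Definition lambda_max (R : realType) (p : nat) (A : 'M[R]_p) : R :=
  sup [set a : R | eigenvalue A a].

Definition mutually_independent (R : realType) (d d' : measure_display)
    (T : measurableType d) (T' : measurableType d') (P : probability T R)
    (I : finType) (X : I -> {RV P >-> T'}) : Prop :=
  forall (J : {set I}) (B : I -> set T'),
    (forall i, i \in J -> measurable (B i)) ->
    P [set w | forall i, i \in J -> B i (X i w)] =
    (\prod_(i in J) P (X i @^-1` B i))%E.

(* The law N(0, I_p) on R^p, i.e., the p-fold product of N(0, 1), which is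
   determined by its values on measurable boxes. In [normal_prob m s] the
   parameter s is the standard deviation. The type [p.-tuple R] carries the
   product sigma-algebra. *)
Definition is_std_gaussian (R : realType) (p : nat)
    (mu : set (p.-tuple R) -> \bar R) : Prop :=
  forall B : 'I_p -> set R, (forall j, measurable (B j)) ->
    mu [set x | forall j, B j (tnth x j)] =
    (\prod_(j < p) normal_prob (0 : R) 1 (B j))%E.

Definition iid_std_gaussian_rows (R : realType) (d : measure_display)
    (T : measurableType d) (P : probability T R) (n p : nat)
    (X : 'I_n -> {RV P >-> p.-tuple R}) : Prop :=
  mutually_independent X /\
  forall i, is_std_gaussian (distribution P (X i)).

Definition data_matrix (R : realType) (d : measure_display)
    (T : measurableType d) (P : probability T R) (n p : nat)
    (X : 'I_n -> {RV P >-> p.-tuple R}) (w : T) : 'M[R]_(n, p) :=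
  \matrix_(i < n, j < p) tnth (X i w) j.

Definition sample_cov (R : realType) (n p : nat) (X : 'M[R]_(n, p)) : 'M[R]_p :=
  n%:R^-1 *: (X^T *m X).

(* [P] is a total function on sets, with an unspecified value outside the
   sigma-algebra, so the bound is read as one on the inner probability. On a
   measurable event this is q <= P E. *)
Definition prob_at_least (R : realType) (d : measure_display)
    (T : measurableType d) (P : probability T R) (E : set T) (q : R) : Prop :=
  exists A : set T, [/\ measurable A, A `<=` E & (q%:E <= P A)%E].

(* Main.v *)
Require Import Defs.
From HB Require Import structures.
From mathcomp Require Import all_boot all_order all_algebra.
From mathcomp Require Import all_classical all_reals all_analysis.
From mathcomp Require Import perm measurable_realfun ring lra.

(** The optimality conditions of the convex program give, for the all-ones
    vector [1] and [Sigma = Theta^-1],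
      [1^T Sigma 1 >= sum_j S_jj + sum_(j != k) max 0 S_jk]:
    decreasing [Theta] along the 0/1 matrix supported on the diagonal and on the
    positive entries of [S] stays feasible, and [Sigma] is entrywise nonnegative
    as the inverse of an M-matrix. Since [S_jk] is of order [1 / sqrt n] and
    positive for about half of the pairs, the Rayleigh quotient of [1] exceeds [1]
    by a multiple of [p / sqrt n].

    The minimizer exists as soon as the off-diagonal entries of [S] are bounded
    by a constant smaller than the diagonal ones, which holds outside an event of
    probability at most [p^2 exp (- c n)]; as the claim is void unless
    [3 p exp (- c2 n) < 1], this is absorbed in the bound.

    Given the [j]-th column [u] of [X], the inner products of [u] with the other
    columns are independent [N(0, |u|^2)], and a Chernoff bound, based on an upper
    bound of [exp (- max 0 z)] by a combination of exponentials of multiples of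
    [z], shows that the sum of their positive parts is at least [c p |u|]. *)

Set Implicit Arguments.
Unset Strict Implicit.
Unset Printing Implicit Defensive.

Import Order.TTheory GRing.Theory Num.Theory.
Import numFieldNormedType.Exports.

Local Open Scope classical_set_scope.
Local Open Scope ring_scope.

(** * Fubini for independent blocks of random variables *)

Section sub_sigma.
Context (R : realType) d (T : measurableType d) (P : probability T R) (I : finType).
Variable Y : I -> {RV P >-> R}.

Definition boxes (J : {set I}) : set (set T) :=
  [set A | exists2 B : I -> set R, (forall i, measurable (B i)) &
                    A = [set w | forall i, i \in J -> B i (Y i w)]].

(** The points are those of [T], with the sigma-algebra generated by the [Y i], [i \in J]:
    measurability on [subT J] expresses dependence on these variables only. *)
Definition subT (J : {set I}) := g_sigma_algebraType (boxes J).

Lemma measurable_box (J : {set I}) (B : I -> set R) :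
  (forall i, measurable (B i)) ->
  measurable [set w | forall i, i \in J -> B i (Y i w)].
Proof.
move=> mB.
rewrite (_ : mkset _ = \bigcap_(i in [set` J]) (Y i @^-1` B i)); last first.
  by apply/seteqP; split=> w /= Bw i /Bw.
apply: fin_bigcap_measurable; first exact: finite_finset.
by move=> i _; rewrite -[X in measurable X]setTI; exact: measurable_funPT.
Qed.

Lemma boxes_measurable (J : {set I}) : boxes J `<=` measurable.
Proof. by move=> _ [B mB ->]; exact: measurable_box. Qed.

Lemma boxesT (J : {set I}) : boxes J setT.
Proof. by exists (fun=> setT) => //; apply/seteqP; split. Qed.

Lemma boxes_setI (J : {set I}) : setI_closed (boxes J).
Proof.
move=> _ _ [B1 mB1 ->] [B2 mB2 ->]; exists (fun i => B1 i `&` B2 i).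
  by move=> i; exact: measurableI.
apply/seteqP; split=> w /=.
  by move=> [h1 h2] i iJ; split; [exact: h1|exact: h2].
by move=> h; split=> i /h[].
Qed.

Lemma subT_measurable (J : {set I}) (A : set T) :
  measurable (A : set (subT J)) -> measurable A.
Proof.
apply: smallest_sub => //; [exact: sigma_algebra_measurable|exact: boxes_measurable].
Qed.

Lemma subT_mono (J J' : {set I}) (A : set T) : J \subset J' ->
  measurable (A : set (subT J)) -> measurable (A : set (subT J')).
Proof.
move=> JJ'; apply: smallest_sub; first exact: smallest_sigma_algebra.
move=> _ [B mB ->]; apply: sub_sigma_algebra.
exists (fun i => if i \in J then B i else setT).
  by move=> i; case: ifP.
apply/seteqP; split=> w /=; first by move=> h i _; case: ifP => // /h.
by move=> h i iJ; have := h i (fintype.subsetP JJ' _ iJ); rewrite iJ.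
Qed.

Lemma measurable_id_subT (J : {set I}) : measurable_fun setT (id : T -> subT J).
Proof. by move=> _ A mA; rewrite setTI; exact: subT_measurable mA. Qed.

Lemma measurable_subT_fun d' (T' : measurableType d') (J : {set I}) (f : T -> T') :
  measurable_fun setT (f : subT J -> T') -> measurable_fun setT f.
Proof.
by move=> mf _ A mA; apply: (@subT_measurable J); exact: mf.
Qed.

Lemma measurable_fun_subT_mono d' (T' : measurableType d') (J J' : {set I})
    (f : T -> T') : J \subset J' ->
  measurable_fun setT (f : subT J -> T') -> measurable_fun setT (f : subT J' -> T').
Proof. by move=> JJ' mf _ A mA; apply: (subT_mono JJ'); exact: mf. Qed.

Lemma measurable_coord (J : {set I}) (i : I) : i \in J ->
  measurable_fun setT (Y i : subT J -> R).
Proof.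
move=> iJ _ A mA; rewrite setTI; apply: sub_sigma_algebra.
exists (fun k => if k == i then A else setT); first by move=> k; case: ifP.
apply/seteqP; split=> w /=; first by move=> Aw k _; case: eqP => [->|].
by move=> /(_ i iJ); rewrite eqxx.
Qed.

Hypothesis indY : mutually_independent Y.

(** The two boxes glue into one box over [J1 :|: J2], and mutual independence factors all three
    probabilities. *)
Lemma boxes_indep (J1 J2 : {set I}) A1 A2 : fintype.disjoint (mem J1) (mem J2) ->
  boxes J1 A1 -> boxes J2 A2 -> P (A1 `&` A2) = (P A1 * P A2)%E.
Proof.
move=> dJ [B1 mB1 ->] [B2 mB2 ->].
pose B i := if i \in J1 then B1 i else B2 i.
have mB i : measurable (B i) by rewrite /B; case: ifP.
have J2E i : i \in J2 -> (i \in J1) = false.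
  by move=> iJ2; apply: contraTF dJ => iJ1; apply/pred0Pn; exists i; rewrite /= iJ1.
rewrite indY // indY //.
rewrite (_ : _ `&` _ = [set w | forall i, i \in J1 :|: J2 -> B i (Y i w)]).
  rewrite indY // (eq_bigl (fun i => (i \in J1) || (i \in J2))); last first.
    by move=> i; rewrite inE.
  rewrite bigU //=; congr (_ * _)%E; apply: eq_bigr => i iJ; rewrite /B.
    by rewrite iJ.
  by rewrite J2E.
apply/seteqP; split=> w /=.
  by move=> [h1 h2] i; rewrite inE /B; case: ifP => [i1 _|_ /= i2]; [exact: h1|exact: h2].
move=> h; split=> i iJ; have := h i; rewrite inE iJ ?orbT /B => /(_ isT).
  by rewrite iJ.
by rewrite J2E.
Qed.

(** The boxes form a pi-system, on which finite measures are compared; first [A1], then [A2], is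
    reduced to a box. *)
Lemma subT_indep (J1 J2 : {set I}) A1 A2 : fintype.disjoint (mem J1) (mem J2) ->
  measurable (A1 : set (subT J1)) -> measurable (A2 : set (subT J2)) ->
  P (A1 `&` A2) = (P A1 * P A2)%E.
Proof.
move=> dJ.
have step J' A (mA : measurable A) :
    (forall B, boxes J' B -> P (B `&` A) = (P B * P A)%E) ->
    forall B, measurable (B : set (subT J')) -> P (B `&` A) = (P B * P A)%E.
  move=> H B mB.
  have PA : P A \is a fin_num by exact: fin_num_measure.
  have c0 : 0 <= fine (P A) by exact: fine_ge0.
  (* For fixed [A] both sides are finite measures in [B]: the restriction of [P] to [A] and a
     multiple of [P]. *)
  pose m1 : {measure set T -> \bar R} := mrestr P mA.
  pose m2 : {measure set T -> \bar R} := mscale (NngNum c0) P.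
  rewrite -[LHS]/(m1 B) [RHS]muleC -[in RHS](fineK PA) -[RHS]/(m2 B).
  apply: (g_sigma_algebra_measure_unique (boxes J') _ (fun=> setT)) => //.
  - exact: boxes_measurable.
  - by move=> ?; exact: boxesT.
  - by apply/seteqP; split=> // x _; exists 0%N.
  - exact: boxes_setI.
  - move=> B' /H; rewrite /= /mrestr /mscale /= => ->.
    by rewrite fineK // muleC.
  - by move=> _; rewrite -ge0_fin_numE // fin_num_measure.
move=> mA1 mA2.
apply: (step J1 A2 (subT_measurable mA2) _ A1 mA1) => B1 BB1.
rewrite setIC muleC.
apply: (step J2 B1 (boxes_measurable BB1) _ A2 mA2) => B2 BB2.
by rewrite setIC muleC; exact: boxes_indep BB1 BB2.
Qed.

(* No joint law is formed: both integrals on the right are over [T] itself, and the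
   two arguments of [F] only see the independent sub-sigma-algebras. *)
Lemma indep_fubini (J1 J2 : {set I}) (F : subT J1 * subT J2 -> \bar R) :
  fintype.disjoint (mem J1) (mem J2) ->
  measurable_fun setT F ->
  (forall x, (0 <= F x)%E) ->
  (\int[P]_w F (w, w) = \int[P]_w \int[P]_w' F (w, w'))%E.
Proof.
move=> dJ mF F0.
have mid1 := @measurable_id_subT J1.
have mid2 := @measurable_id_subT J2.
pose X1 : {mfun T >-> subT J1} :=
  HB.pack (id : T -> subT J1) (isMeasurableFun.Build _ _ _ _ _ mid1).
pose X2 : {mfun T >-> subT J2} :=
  HB.pack (id : T -> subT J2) (isMeasurableFun.Build _ _ _ _ _ mid2).
pose m1 := distribution P X1.
pose m2 := distribution P X2.
(* Independence makes the image of [P] under the diagonal the product of [m1] and [m2], so that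
   Tonelli's theorem applies. *)
pose D := fun w : T => ((w : subT J1), (w : subT J2)).
have mD : measurable_fun setT D by exact: measurable_fun_pair.
pose XD : {mfun T >-> (subT J1 * subT J2)%type} :=
  HB.pack D (isMeasurableFun.Build _ _ _ _ _ mD).
pose m' := distribution P XD.
have m'E : forall A, measurable A -> (m1 \x m2)%E A = m' A.
  apply: product_measure_unique => A B mA mB.
  by have := @subT_indep J1 J2 A B dJ mA mB.
transitivity (\int[m']_z F z)%E.
  by rewrite ge0_integral_pushforward.
transitivity (\int[(m1 \x m2)%E]_z F z)%E.
  by apply: eq_measure_integral => A mA _; exact/esym/m'E.
rewrite fubini_tonelli1 // ge0_integral_pushforward //; last first.
- by move=> x _; exact: integral_ge0.
- exact: measurable_fun_fubini_tonelli_F.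
apply: eq_integral => w _ /=; rewrite /fubini_F ge0_integral_pushforward //.
exact: measurableT_comp.
Qed.

Lemma measurable_integral_subT (J1 J2 : {set I}) (F : subT J1 * subT J2 -> \bar R) :
  measurable_fun setT F -> (forall x, (0 <= F x)%E) ->
  measurable_fun setT (fun w : T => \int[P]_w' F (w, w'))%E.
Proof.
move=> mF F0; have mid2 := @measurable_id_subT J2.
pose X2 : {mfun T >-> subT J2} :=
  HB.pack (id : T -> subT J2) (isMeasurableFun.Build _ _ _ _ _ mid2).
apply: (@measurable_subT_fun _ (\bar R) J1 (fun w => \int[P]_w' F (w, w'))%E).
apply: (eq_measurable_fun (fubini_F (distribution P X2) F)).
  move=> w _; rewrite /fubini_F ge0_integral_pushforward //.
  exact: measurableT_comp.
exact: measurable_fun_fubini_tonelli_F.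
Qed.

(** Induction on [s]: the block of the head is disjoint from the union of the blocks of the tail,
    and [indep_fubini] separates them. *)
Lemma indep_prod (K : eqType) (s : seq K) (g : K -> {set I}) (f : K -> T -> R) :
  uniq s -> (forall k l, k != l -> fintype.disjoint (mem (g k)) (mem (g l))) ->
  (forall k, measurable_fun setT (f k : subT (g k) -> R)) ->
  (forall k w, 0 <= f k w) ->
  (\int[P]_w (\prod_(k <- s) f k w)%:E = \prod_(k <- s) \int[P]_w (f k w)%:E)%E.
Proof.
move=> us dg mf f0; elim: s us => [_|k s IH /= /andP[ks us]].
  under eq_integral do rewrite big_nil.
  by rewrite big_nil integral_cst //= mul1e; exact: probability_setT.
under eq_integral do rewrite big_cons.
rewrite big_cons -IH //.
pose J2 : {set I} := finset (fun i => has (fun l => i \in g l) s).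
have sub l : l \in s -> g l \subset J2.
  move=> ls; apply/fintype.subsetP => i il; rewrite inE.
  by apply/hasP; exists l.
have dJ : fintype.disjoint (mem (g k)) (mem J2).
  apply/pred0P => i /=; apply/negP => /andP[ik].
  rewrite inE => /hasP[l ls il].
  have kl : k != l by apply: contraNneq ks => ->.
  by have := dg _ _ kl => /pred0P/(_ i) /=; rewrite ik il.
have mG : measurable_fun setT ((fun w => \prod_(l <- s) f l w) : subT J2 -> R).
  (* Only the blocks of members of [s] are known to lie in [J2]; the factors at other indices, which
     do not occur, are replaced by 1. *)
  rewrite (_ : (fun w => _) =
      (fun w => \prod_(l <- s) (if l \in s then f l w else 1))); last first.
    by apply/funext => w; rewrite big_seq [RHS]big_seq; apply: eq_bigr => l ->.
  apply: measurable_prod => l ls; rewrite ls.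
  by apply: measurable_fun_subT_mono (mf l); exact: sub.
have G0 w : 0 <= \prod_(l <- s) f l w by apply: prodr_ge0.
rewrite (@indep_fubini (g k) J2
  (fun z => (f k z.1 * \prod_(l <- s) f l z.2)%:E)) //; last 2 first.
- apply/measurable_EFinP; apply: measurable_funM.
    by apply: (measurableT_comp (mf k)).
  by apply: (measurableT_comp mG).
- by move=> x; rewrite lee_fin mulr_ge0.
under eq_integral => w _.
  under eq_integral do rewrite /= EFinM.
  rewrite ge0_integralZl_EFin //; last 2 first.
  + by move=> x _; rewrite lee_fin.
  + by apply/measurable_EFinP; exact: measurable_subT_fun mG.
  over.
rewrite ge0_integralZr //.
- by apply/measurable_EFinP; exact: measurable_subT_fun (mf k).
- by move=> w _; rewrite lee_fin.
- by apply: integral_ge0 => w _; rewrite lee_fin.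
Qed.
End sub_sigma.

(** * Gaussian tails *)

Section normal_integral.
Context (R : realType).
Local Notation mu := lebesgue_measure.

(** The density [normal_pdf] and the Radon-Nikodym derivative have the same integrals over all
    measurable sets, hence agree almost everywhere. *)
Lemma ge0_integral_normal_prob (m s : R) (f : R -> \bar R) :
  measurable_fun setT f -> (forall x, (0 <= f x)%E) ->
  (\int[normal_prob m s]_x f x = \int[mu]_x (f x * (normal_pdf m s x)%:E))%E.
Proof.
move=> mf f0; have dom := normal_prob_dominates m s.
have mpdf : measurable_fun setT (EFin \o normal_pdf m s).
  by apply/measurable_EFinP; exact: measurable_normal_pdf.
have mRN := measurable_int _ (Radon_Nikodym_SigmaFinite.f_integrable dom).
rewrite -(Radon_Nikodym_SigmaFinite.change_of_variables dom) //.
apply: ae_eq_integral => //; [exact: emeasurable_funM|exact: emeasurable_funM|].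
apply: ae_eqe_mul2l; apply: integral_ae_eq => //.
  exact: Radon_Nikodym_SigmaFinite.f_integrable.
by move=> E _ mE; rewrite -Radon_Nikodym_SigmaFinite.f_integral.
Qed.

Lemma normal_pdf_peakE (m s x : R) : s != 0 ->
  normal_pdf m s x = normal_peak s * normal_fun m s x.
Proof. by move=> s0; rewrite normal_pdfE. Qed.

(** Completing the square turns the tilted N(0, 1) density into a multiple of the N(t, 1)
    density. *)
Lemma normal_expR_linear (t : R) :
  (\int[normal_prob 0 1]_x (expR (t * x))%:E = (expR (t ^+ 2 / 2))%:E)%E.
Proof.
rewrite ge0_integral_normal_prob; last 2 first.
- by apply/measurable_EFinP; apply: measurableT_comp => //; exact: measurable_funM.
- by move=> x; rewrite lee_fin expR_ge0.
have E x : expR (t * x) * normal_pdf 0 1 x = expR (t ^+ 2 / 2) * normal_pdf t 1 x.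
  rewrite !normal_pdf_peakE ?oner_eq0 // mulrCA [RHS]mulrCA; congr (_ * _).
  by rewrite /normal_fun -!expRD; congr expR; field.
under eq_integral do rewrite -EFinM E EFinM.
rewrite ge0_integralZl_EFin ?expR_ge0 //; last 2 first.
- by move=> x _; rewrite lee_fin normal_pdf_ge0.
- by apply/measurable_EFinP; exact: measurable_normal_pdf.
by rewrite integral_normal_pdf mule1.
Qed.

(** The tilted density is [s = (1 - a)^(-1/2)] times that of N(0, s^2), so the integral equals [s],
    and [s^2 = 1 + (s^2 - 1) <= exp (s^2 - 1)]. *)
Lemma normal_expR_square (a : R) : a < 1 ->
  (\int[normal_prob 0 1]_x (expR (a * x ^+ 2 / 2))%:E <=
   (expR (a / (2 * (1 - a))))%:E)%E.
Proof.
move=> a1; have b0 : 0 < 1 - a by rewrite subr_gt0.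
rewrite ge0_integral_normal_prob; last 2 first.
- apply/measurable_EFinP; apply: measurableT_comp => //.
  by do 2 apply: measurable_funM => //; exact: measurable_funX.
- by move=> x; rewrite lee_fin expR_ge0.
pose s := (Num.sqrt (1 - a))^-1.
have s0 : 0 < s by rewrite invr_gt0 sqrtr_gt0.
have s2 : s ^+ 2 = (1 - a)^-1 by rewrite exprVn sqr_sqrtr // ltW.
have E x : expR (a * x ^+ 2 / 2) * normal_pdf 0 1 x = s * normal_pdf 0 s x.
  rewrite !normal_pdf_peakE ?oner_eq0 ?gt_eqF // mulrCA [RHS]mulrA; congr (_ * _).
    rewrite /normal_peak expr1n mul1r -mulrnAr.
    rewrite [Num.sqrt (s ^+ 2 * _)]sqrtrM ?sqr_ge0 // sqrtr_sqr gtr0_norm //.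
    by rewrite invfM mulrA mulfV ?mul1r // gt_eqF.
  rewrite /normal_fun -!expRD s2; congr expR; field.
  by rewrite gt_eqF.
under eq_integral do rewrite -EFinM E EFinM.
rewrite ge0_integralZl_EFin ?(ltW s0) //; last 2 first.
- by move=> x _; rewrite lee_fin normal_pdf_ge0.
- by apply/measurable_EFinP; exact: measurable_normal_pdf.
rewrite integral_normal_pdf mule1 lee_fin.
rewrite -(ler_pXn2r (n:=2)) // ?nnegrE ?expR_ge0 ?(ltW s0) //.
rewrite s2 -expRM_natl.
have -> : 2%:R * (a / (2 * (1 - a))) = (1 - a)^-1 - 1.
  by field; rewrite gt_eqF.
by have := expR_ge1Dx ((1 - a)^-1 - 1); rewrite addrC subrK.
Qed.
End normal_integral.

(** * The entries of the data matrix as independent standard Gaussians *)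

Section entries.
Context (R : realType) d (T : measurableType d) (P : probability T R) (n p : nat).
Variable X : 'I_n -> {RV P >-> p.-tuple R}.

Lemma measurable_entry (k : 'I_n * 'I_p) :
  measurable_fun setT (fun w => tnth (X k.1 w) k.2).
Proof. by apply: (measurableT_comp (measurable_tnth k.2)) => //. Qed.

Definition entry (k : 'I_n * 'I_p) : {RV P >-> R} :=
  HB.pack (fun w => tnth (X k.1 w) k.2)
    (isMeasurableFun.Build _ _ _ _ _ (measurable_entry k)).

Hypothesis iidX : iid_std_gaussian_rows X.

Lemma entry_law (k : 'I_n * 'I_p) (B : set R) : measurable B ->
  P (entry k @^-1` B) = normal_prob 0 1 B.
Proof.
move=> mB; have [_ /(_ k.1)] := iidX.
move=> /(_ (fun j => if j == k.2 then B else setT)) H.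
rewrite (_ : entry k @^-1` B = X k.1 @^-1`
    [set x | forall j, (if j == k.2 then B else setT) (tnth x j)]); last first.
  apply/seteqP; split=> w /=; first by move=> Bw j; case: eqP => [->|].
  by move=> /(_ k.2); rewrite eqxx.
rewrite [LHS]H; last by move=> j; case: eqP.
rewrite (bigD1 k.2) //= eqxx big1 ?mule1 // => j /negPf ->.
exact: probability_setT.
Qed.

(** A box over [J] is padded by [setT] to a box over all entries, an intersection of row events;
    independence of the rows and the product form of each row law factor it. *)
Lemma entries_independent : mutually_independent entry.
Proof.
move=> J B mB; have [indX gX] := iidX.
pose B' k := if k \in J then B k else setT.
have mB' k : measurable (B' k) by rewrite /B'; case: ifPn => // /mB.
pose box i := [set x : p.-tuple R | forall j, B' (i, j) (tnth x j)].
have mbox i : measurable (box i).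
  rewrite (_ : box i = \bigcap_(j in setT) ((@tnth p R ^~ j) @^-1` B' (i, j))).
    apply: fin_bigcap_measurable => // j _.
    by rewrite -[X in measurable X]setTI; exact: measurable_tnth.
  by apply/seteqP; split=> x /= h j => [_|]; apply: h.
rewrite (_ : [set w | _] =
    [set w | forall i, i \in [set: 'I_n]%SET -> box i (X i w)]); last first.
  apply/seteqP; split=> w /= h.
    by move=> i _ j; rewrite /B'; case: ifPn => // /h.
  by move=> [i j] ijJ; have := h i (finset.in_setT i) j; rewrite /B' ijJ.
rewrite indX //.
transitivity (\prod_(k : 'I_n * 'I_p) normal_prob (0 : R) 1 (B' k))%E.
  transitivity (\prod_i \prod_j normal_prob (0 : R) 1 (B' (i, j)))%E.
    by apply: eq_big => i; [rewrite finset.in_setT|move=> _; exact: gX].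
  by rewrite pair_bigA /=; apply: eq_bigr => -[i j].
rewrite [RHS]big_mkcond /=; apply: eq_bigr => k _; rewrite /B'.
by case: ifPn => [/mB/entry_law ->//|_]; exact: probability_setT.
Qed.

Lemma integral_entry (k : 'I_n * 'I_p) (f : R -> \bar R) :
  measurable_fun setT f -> (forall x, (0 <= f x)%E) ->
  (\int[P]_w f (entry k w) = \int[normal_prob 0 1]_x f x)%E.
Proof.
move=> mf f0.
have mY : measurable_fun setT (entry k : T -> measurableTypeR R).
  by move=> _ A mA; exact: (@measurable_funPT _ _ _ _ (entry k) measurableT A mA).
pose Z : {mfun T >-> measurableTypeR R} :=
  HB.pack (entry k : T -> measurableTypeR R) (isMeasurableFun.Build _ _ _ _ _ mY).
transitivity (\int[distribution P Z]_x f x)%E.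
  by rewrite ge0_integral_pushforward.
by apply: eq_measure_integral => A mA _; exact: entry_law.
Qed.
End entries.

(** * Tools for Chernoff bounds *)

Section chernoff.
Context (R : realType) d (T : measurableType d) (P : probability T R).

(** Markov's inequality in the form used by the Chernoff bounds: [G] dominates the indicator of
    [A]. *)
Lemma prob_le_integral (A : set T) (G : T -> R) : measurable A ->
  measurable_fun setT G -> (forall w, 0 <= G w) -> (forall w, A w -> 1 <= G w) ->
  (P A <= \int[P]_w (G w)%:E)%E.
Proof.
move=> mA mG G0 GA.
rewrite -[A in X in (X <= _)%E]setIT -[X in (X <= _)%E]integral_indic //.
apply: ge0_le_integral => //.
- exact/measurable_EFinP/measurable_indic.
- exact/measurable_EFinP.
- move=> w _; rewrite lee_fin indicE; case: (boolP (w \in A)) => //=.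
  by rewrite inE => /GA.
Qed.

Lemma prod_expR_le (K : Type) (s : seq K) (g : K -> \bar R) (c : R) :
  (forall k, 0 <= g k)%E -> (forall k, g k <= (expR c)%:E)%E ->
  (\prod_(k <- s) g k <= (expR ((size s)%:R * c))%:E)%E.
Proof.
move=> g0 gc; elim: s => [|k s IH]; first by rewrite big_nil /= mul0r expR0.
rewrite big_cons /= -natr1 mulrDl mul1r addrC expRD EFinM.
by apply: lee_pmul => //; apply: prode_ge0.
Qed.

Lemma measurable_set_ler d' (T' : measurableType d') (f g : T' -> R) :
  measurable_fun setT f -> measurable_fun setT g ->
  measurable [set w | f w <= g w].
Proof.
move=> mf mg.
rewrite (_ : [set w | _] = (g \- f) @^-1` `[0, +oo[%classic); last first.
  by apply/seteqP; split=> w /=; rewrite in_itv /= andbT subr_ge0.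
by rewrite -[X in measurable X]setTI; apply: (measurable_funB mg mf).
Qed.
End chernoff.

(** * Tails of chi-square variables and of inner products of two columns *)

Section tails.
Context (R : realType) d (T : measurableType d) (P : probability T R) (n p : nat).
Variable X : 'I_n -> {RV P >-> p.-tuple R}.
Hypothesis iidX : iid_std_gaussian_rows X.
Local Notation Y := (entry X).
Local Notation indY := (entries_independent iidX).

Lemma measurable_entry_sub (J : {set 'I_n * 'I_p}) k : k \in J ->
  measurable_fun setT (Y k : subT Y J -> R).
Proof. exact: measurable_coord. Qed.

Lemma disjoint_singletons (k l : 'I_n * 'I_p) : k != l ->
  fintype.disjoint (mem [set k]%SET) (mem [set l]%SET).
Proof.
move=> kl; apply/pred0P => i /=; apply/negP => /andP[].
by rewrite !inE => /eqP -> /eqP; exact/eqP.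
Qed.

Lemma integral_prod_entries (s : seq ('I_n * 'I_p)) (f : 'I_n * 'I_p -> R -> R) :
  uniq s -> (forall k, measurable_fun setT (f k)) -> (forall k x, 0 <= f k x) ->
  (\int[P]_w (\prod_(k <- s) f k (Y k w))%:E =
   \prod_(k <- s) \int[normal_prob 0 1]_x (f k x)%:E)%E.
Proof.
move=> us mf f0.
rewrite (indep_prod indY us (g := fun k => [set k]%SET)
  (f := fun k w => f k (Y k w))) //.
- apply: eq_bigr => k _.
  apply: (integral_entry iidX k (f := fun x => (f k x)%:E)).
    exact/measurable_EFinP.
  by move=> x; rewrite lee_fin.
- exact: disjoint_singletons.
- move=> k; apply: (measurableT_comp (mf k)).
  by apply: measurable_entry_sub; rewrite inE.
Qed.

(** Chernoff bound with [exp (- t Y^2)], whose expectation is at most [exp (- t + 2 t^2)] for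
    [t >= 0]. *)
Lemma chi2_lower_tail (s : seq ('I_n * 'I_p)) (eta : R) : uniq s -> 0 <= eta ->
  (P [set w | (\sum_(k <- s) Y k w ^+ 2 <= (size s)%:R * (1 - eta))%R] <=
   (expR (- ((size s)%:R * eta ^+ 2 / 8)))%:E)%E.
Proof.
(* The value [eta / 4] minimizes the exponent [N (2 t^2 - t eta)]. *)
move=> us eta0; set N := (size s)%:R : R; pose t := eta / 4.
have t0 : 0 <= t by rewrite divr_ge0.
have mS : measurable_fun setT (fun w => \sum_(k <- s) Y k w ^+ 2).
  by apply: measurable_sum => k; apply: measurable_funX.
apply: (@le_trans _ _ (\int[P]_w
   (expR (t * (N * (1 - eta) - \sum_(k <- s) Y k w ^+ 2)))%:E)%E).
  apply: prob_le_integral => //.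
  - exact: measurable_set_ler.
  - apply: measurableT_comp => //; apply: measurable_funM => //.
    by apply: measurable_funB => //.
  - move=> w /= h; rewrite -[leLHS]expR0 ler_expR mulr_ge0 // subr_ge0 //.
under eq_integral => w _.
  rewrite mulrBr expRD -mulrN -sumrN mulr_sumr expR_sum EFinM.
  under eq_bigr => k _.
    rewrite (_ : t * _ = (- (2 * t)) * Y k w ^+ 2 / 2); last by field.
    over.
  over.
have mE : measurable_fun setT (fun x : R => expR (- (2 * t) * x ^+ 2 / 2)).
  apply: measurableT_comp => //.
  by do 2 apply: measurable_funM => //; exact: measurable_funX.
rewrite ge0_integralZl_EFin ?expR_ge0 //; last 2 first.
- by move=> w _; rewrite lee_fin prodr_ge0 // => k _; exact: expR_ge0.
- apply/measurable_EFinP; apply: measurable_prod => k _.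
  exact: (measurableT_comp mE).
rewrite (@integral_prod_entries s (fun _ x => expR (- (2 * t) * x ^+ 2 / 2))) //.
rewrite -/N.
apply: (@le_trans _ _ ((expR (t * (N * (1 - eta))))%:E *
    (expR (N * (- t + 2 * t ^+ 2)))%:E)%E).
  apply: lee_pmul => //; rewrite ?lee_fin ?expR_ge0 //.
    by apply: prode_ge0 => k _; apply: integral_ge0 => x _; rewrite lee_fin expR_ge0.
  apply: prod_expR_le => k; first by apply: integral_ge0 => x _; rewrite lee_fin expR_ge0.
  apply: le_trans (normal_expR_square _) _; first lra.
  rewrite lee_fin ler_expR ler_pdivrMr; last lra.
  have := mulr_ge0 t0 (mulr_ge0 t0 t0); rewrite !expr2; nra.
rewrite -EFinM lee_fin -expRD ler_expR /t.
by rewrite le_eqVlt; apply/orP; left; apply/eqP; field.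
Qed.

(** Columns occur in two forms: as sets, to index sub-sigma-algebras, and as lists ([col_seq]), to
    index products. *)
Definition col_set (k : 'I_p) : {set 'I_n * 'I_p} := finset (fun x => x.2 == k).

Lemma disjoint_col (k l : 'I_p) : k != l ->
  fintype.disjoint (mem (col_set k)) (mem (col_set l)).
Proof.
move=> kl; apply/pred0P => i /=; apply/negP => /andP[].
by rewrite !inE => /eqP -> /eqP; exact/eqP.
Qed.

Definition col_seq (k : 'I_p) : seq ('I_n * 'I_p) := [seq (i, k) | i <- enum 'I_n].

Lemma col_seq_uniq k : uniq (col_seq k).
Proof. by rewrite map_inj_uniq ?enum_uniq // => i j []. Qed.

Lemma size_col_seq k : size (col_seq k) = n.
Proof. by rewrite size_map size_enum_ord. Qed.

Lemma mgf_column (k : 'I_p) (u : 'I_n -> R) :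
  (\int[P]_w (expR (\sum_i u i * Y (i, k) w))%:E =
   (expR ((\sum_i u i ^+ 2) / 2))%:E)%E.
Proof.
under eq_integral => w _.
  rewrite expR_sum.
  rewrite (_ : \prod_i _ = \prod_(x <- col_seq k) expR (u x.1 * Y x w)); last first.
    by rewrite big_map big_enum.
  over.
rewrite (@integral_prod_entries (col_seq k) (fun x y => expR (u x.1 * y)))
  ?col_seq_uniq //; last first.
  by move=> x; apply: measurableT_comp => //; exact: measurable_funM.
under eq_bigr do rewrite normal_expR_linear.
by rewrite big_map big_enum /= prodEFin -expR_sum mulr_suml.
Qed.

(** Given column [j], the inner product is N(0, |X_j|^2); at Chernoff parameter 1/2 its conditional
    exponential moment is [exp (|X_j|^2 / 8)], a product of terms as in [normal_expR_square] with
    [a = 1/4]. The resulting exponent is [- n / 4 + n / 6]. *)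
Lemma inner_product_tail (j k : 'I_p) : j != k ->
  (P [set w | (n%:R / 2 <= \sum_i Y (i, j) w * Y (i, k) w)%R] <=
   (expR (- (n%:R / 12)))%:E)%E.
Proof.
move=> jk.
have mS : measurable_fun setT (fun w => \sum_i Y (i, j) w * Y (i, k) w).
  by apply: measurable_sum => i; apply: measurable_funM.
apply: (@le_trans _ _ (\int[P]_w
   (expR (2^-1 * (\sum_i Y (i, j) w * Y (i, k) w - n%:R / 2)))%:E)%E).
  apply: prob_le_integral => //.
  - exact: measurable_set_ler.
  - apply: measurableT_comp => //; apply: measurable_funM => //.
    by apply: measurable_funB => //.
  - by move=> w /= h; rewrite -[leLHS]expR0 ler_expR mulr_ge0 // subr_ge0.
under eq_integral => w _.
  rewrite mulrBr addrC expRD EFinM mulr_sumr.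
  under eq_bigr do rewrite mulrA.
  over.
rewrite ge0_integralZl_EFin ?expR_ge0 //; last first.
  apply/measurable_EFinP; apply: measurableT_comp => //.
  apply: measurable_sum => i; apply: measurable_funM => //.
  by apply: measurable_funM.
rewrite (@indep_fubini _ _ _ _ _ Y indY (col_set j) (col_set k)
  (fun z => (expR (\sum_i (2^-1 * Y (i, j) z.1) * Y (i, k) z.2))%:E)) //; last 2 first.
- exact: disjoint_col.
- apply/measurable_EFinP; apply: measurableT_comp => //.
  apply: measurable_sum => i; apply: measurable_funM => //.
    apply: measurable_funM => //.
    apply: (measurableT_comp (@measurable_entry_sub (col_set j) (i, j) _)) => //.
    by rewrite inE.
  apply: (measurableT_comp (@measurable_entry_sub (col_set k) (i, k) _)) => //.
  by rewrite inE.
under eq_integral => w _.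
  rewrite (mgf_column k (fun i => 2^-1 * Y (i, j) w)) mulr_suml expR_sum.
  rewrite (_ : \prod_i _ = \prod_(x <- col_seq j) expR (4^-1 * Y x w ^+ 2 / 2)); last first.
    rewrite big_map big_enum; apply: eq_bigr => i _.
    by congr expR; field.
  over.
rewrite (@integral_prod_entries (col_seq j) (fun x y => expR (4^-1 * y ^+ 2 / 2)))
  ?col_seq_uniq //; last first.
  move=> _; apply: measurableT_comp => //.
  by do 2 apply: measurable_funM => //; exact: measurable_funX.
apply: (@le_trans _ _ ((expR (- (2^-1 * (n%:R / 2))))%:E * (expR (n%:R * 6^-1))%:E)%E).
  apply: lee_pmul => //; rewrite ?lee_fin ?expR_ge0 //.
    by apply: prode_ge0 => x _; apply: integral_ge0 => y _; rewrite lee_fin expR_ge0.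
  rewrite -[n in X in (_ <= X)%E](size_col_seq j).
  apply: prod_expR_le => x; first by apply: integral_ge0 => y _; rewrite lee_fin expR_ge0.
  apply: le_trans (normal_expR_square _) _; first lra.
  by rewrite lee_fin ler_expR ler_pdivrMr; lra.
rewrite -EFinM lee_fin -expRD ler_expR; lra.
Qed.

(* [exp (- z_+) <= 1 - (y - 1) / 8 + (y - 1)^4 / (128 y^2)] with [y = exp z]; the
   right-hand side is a combination of exponentials of multiples of [z]. *)
Lemma expR_pos_part_le (z : R) :
  expR (- Num.max 0 z) + (8^-1 + 32^-1) * expR z + 32^-1 * expR (- z) <=
  8^-1 + 1 + 6 / 128 + 128^-1 * expR (2 * z) + 128^-1 * expR (- (2 * z)).
Proof.
have y0 := expR_gt0 z; set y := expR z in y0 *.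
have -> : expR (2 * z) = y ^+ 2 by rewrite expRM_natl.
have -> : expR (- (2 * z)) = y^-1 ^+ 2 by rewrite expRN expRM_natl exprVn.
rewrite !expRN -/y.
have [z0|z0] := leP 0 z.
  have y1 : 1 <= y by rewrite -expR0 ler_expR.
  rewrite -/y -subr_ge0.
  rewrite (_ : _ - _ = (y - 1) * ((y - 1) * ((y - 1 - 8) ^+ 2 + 32) + 112) / (128 * y ^+ 2)).
    apply: divr_ge0; last by rewrite mulr_ge0 // sqr_ge0.
    apply: mulr_ge0; first by rewrite subr_ge0.
    apply: addr_ge0 => //; apply: mulr_ge0; first by rewrite subr_ge0.
    by apply: addr_ge0; rewrite ?sqr_ge0.
  by field; rewrite gt_eqF.
have y1 : y <= 1 by rewrite -expR0 ler_expR ltW.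
rewrite expR0 invr1 -subr_ge0.
rewrite (_ : _ - _ = (1 - y) / 8 + (y - 1) ^+ 4 / (128 * y ^+ 2)).
  apply: addr_ge0; first by rewrite divr_ge0 // subr_ge0.
  by apply: divr_ge0; [rewrite exprn_even_ge0|rewrite mulr_ge0 // sqr_ge0].
by field; rewrite gt_eqF.
Qed.

(** For a centered Gaussian of variance [2 tau] the exponentials in [expR_pos_part_le] have
    expectations 3/2 and [(3/2)^4 = 81/16]. The inequality then bounds the integral by about 0.9697,
    which is below [1 - 3/100]. *)
Lemma expectation_pos_part_le (W : T -> R) (tau : R) : measurable_fun setT W ->
  expR tau = 3 / 2 ->
  (forall m : R, \int[P]_w (expR (m * W w))%:E = (expR (m ^+ 2 * tau))%:E)%E ->
  (\int[P]_w (expR (- Num.max 0 (W w)))%:E <= (expR (- (3 / 100)))%:E)%E.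
Proof.
move=> mW etau mgfW.
have mexp m : measurable_fun setT (fun w => expR (m * W w)).
  by apply: measurableT_comp => //; exact: measurable_funM.
have I1 : (\int[P]_w (expR (W w))%:E = (3 / 2)%:E)%E.
  by have := mgfW 1; rewrite expr1n mul1r etau => <-;
    apply: eq_integral => w _; rewrite mul1r.
have IN1 : (\int[P]_w (expR (- W w))%:E = (3 / 2)%:E)%E.
  by have := mgfW (-1); rewrite sqrrN expr1n mul1r etau => <-;
    apply: eq_integral => w _; rewrite mulN1r.
have e4 : expR (2 ^+ 2 * tau) = 81 / 16.
  by rewrite -natrX expRM_natl etau; field.
have I2 : (\int[P]_w (expR (2 * W w))%:E = (81 / 16)%:E)%E by rewrite mgfW e4.
have IN2 : (\int[P]_w (expR (- (2 * W w)))%:E = (81 / 16)%:E)%E.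
  by under eq_integral do rewrite -mulNr; rewrite mgfW sqrrN e4.
have mW1 : measurable_fun setT (fun w => expR (W w)) by exact: measurableT_comp.
have mWN1 : measurable_fun setT (fun w => expR (- W w)).
  by apply: measurableT_comp => //; exact: measurableT_comp.
have mW2 : measurable_fun setT (fun w => expR (2 * W w)) by exact: mexp.
have mWN2 : measurable_fun setT (fun w => expR (- (2 * W w))).
  by apply: measurableT_comp => //; apply: measurableT_comp => //; exact: measurable_funM.
have mpos : measurable_fun setT (fun w => expR (- Num.max 0 (W w))).
  apply: measurableT_comp => //; apply: measurableT_comp => //.
  exact: measurable_maxr.
have intD (f g : T -> R) : measurable_fun setT f -> measurable_fun setT g ->
    (forall w, 0 <= f w) -> (forall w, 0 <= g w) ->
    (\int[P]_w (f w + g w)%:E = \int[P]_w (f w)%:E + \int[P]_w (g w)%:E)%E.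
  move=> mf mg f0 g0; under eq_integral do rewrite EFinD.
  have ? := (measurable_EFinP _ _).2 mf; have ? := (measurable_EFinP _ _).2 mg.
  by rewrite ge0_integralD // => w _; rewrite lee_fin.
have intZ (c : R) (f : T -> R) : measurable_fun setT f -> 0 <= c ->
    (forall w, 0 <= f w) -> (\int[P]_w (c * f w)%:E = c%:E * \int[P]_w (f w)%:E)%E.
  move=> mf c0 f0; under eq_integral do rewrite EFinM.
  have ? := (measurable_EFinP _ _).2 mf.
  by rewrite ge0_integralZl_EFin // => w _; rewrite lee_fin.
(* The constant is made opaque so that [intD] does not split it. *)
have [c cE] : exists c : R, c = 8^-1 + 1 + 6 / 128 by eexists.
have : (\int[P]_w (expR (- Num.max 0 (W w)) + (8^-1 + 32^-1) * expR (W w) +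
                   32^-1 * expR (- W w))%:E <=
  \int[P]_w (c + 128^-1 * expR (2 * W w) + 128^-1 * expR (- (2 * W w)))%:E)%E.
  apply: ge0_le_integral => //.
  - apply/measurable_EFinP; apply: measurable_funD; last exact: measurable_funM.
    by apply: measurable_funD => //; exact: measurable_funM.
  - apply/measurable_EFinP; apply: measurable_funD; last exact: measurable_funM.
    by apply: measurable_funD => //; exact: measurable_funM.
  - by move=> w _; rewrite lee_fin cE expR_pos_part_le.
have c0 : 0 <= c by rewrite cE; lra.
rewrite !intD; try (by move=> *; rewrite ?addr_ge0 ?mulr_ge0 ?addr_ge0 ?expR_ge0);
  try (by repeat first [apply: measurable_funD|apply: measurable_funM|done]).
rewrite !intZ //; try (by move=> *; rewrite ?addr_ge0 ?expR_ge0).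
rewrite I1 IN1 I2 IN2 integral_cst //= probability_setT mule1.
set I0 := (\int[P]_w (expR (- Num.max 0 (W w)))%:E)%E.
have : (0 <= I0)%E by apply: integral_ge0 => w _; rewrite lee_fin expR_ge0.
case: I0 => [r| |] // _; rewrite -!EFinM -?EFinD.
  rewrite lee_fin => h; rewrite lee_fin.
rewrite cE in h.
  have := expR_ge1Dx (- (3 / 100) : R); lra.
Qed.
End tails.

(** * Positive parts of the inner products with one column *)

Section positive_parts.
Context (R : realType) d (T : measurableType d) (P : probability T R) (n p : nat).
Variable X : 'I_n -> {RV P >-> p.-tuple R}.
Hypothesis iidX : iid_std_gaussian_rows X.
Local Notation Y := (entry X).
Local Notation indY := (entries_independent iidX).

Definition col_sqr (j : 'I_p) (w : T) : R := \sum_i Y (i, j) w ^+ 2.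
Definition pos_dots (j : 'I_p) (w : T) : R :=
  \sum_(k | k != j) Num.max 0 (\sum_i Y (i, j) w * Y (i, k) w).

Lemma measurable_col_sqr (j : 'I_p) :
  measurable_fun setT (col_sqr j : subT Y (col_set n j) -> R).
Proof.
apply: measurable_sum => i; apply: measurable_funX.
by apply: measurable_entry_sub; rewrite inE.
Qed.

Lemma measurable_pos_dots (j : 'I_p) : measurable_fun setT (pos_dots j).
Proof.
rewrite (_ : pos_dots j = fun w => \sum_(k <- [seq k <- enum 'I_p | k != j])
    Num.max 0 (\sum_i Y (i, j) w * Y (i, k) w)); last first.
  by apply/funext => w; rewrite big_filter big_enum_cond.
apply: measurable_sum => k; apply: measurable_maxr => //.
by apply: measurable_sum => i; apply: measurable_funM.
Qed.

(* The power is [1 / |X_j|]; without the first condition it would be [0] at [X_j = 0]. *)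
Definition few_pos_dots (j : 'I_p) : set T :=
  [set w | 0 < col_sqr j w /\ pos_dots j w * col_sqr j w `^ (- 2^-1) <= p.-1%:R / 100].

Lemma measurable_few_pos_dots (j : 'I_p) : measurable (few_pos_dots j).
Proof.
have mq := measurable_subT_fun (@measurable_col_sqr j).
rewrite (_ : few_pos_dots j = (col_sqr j @^-1` `]0, +oo[%classic) `&`
    [set w | pos_dots j w * col_sqr j w `^ (- 2^-1) <= p.-1%:R / 100]); last first.
  by apply/seteqP; split=> w /=; rewrite in_itv /= andbT.
apply: measurableI; first by rewrite -[X in measurable X]setTI; exact: mq.
apply: measurable_set_ler => //; apply: measurable_funM; first exact: measurable_pos_dots.
exact: (measurableT_comp (measurable_powR _) mq).
Qed.

(** Chernoff bound on the normalized inner products. Given a nonzero column [j], the variables [Wf]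
    are independent N(0, 2 tau), and each of the [p - 1] factors is at most
    [exp (1/100 - 3/100)]. *)
Lemma few_pos_dots_tail (j : 'I_p) :
  (P (few_pos_dots j) <= (expR (- (p.-1%:R / 50)))%:E)%E.
Proof.
(* This [tau] is the one of [expectation_pos_part_le]. The scale [t] below turns variance 1 into
   [2 tau], and [t <= 1] ensures that scaling by [t] does not increase the positive parts. *)
pose tau : R := ln (3 / 2).
have etau : expR tau = 3 / 2 by rewrite lnK // posrE; lra.
have tau0 : 0 < tau by apply: ln_gt0; lra.
have tau1 : tau <= 2^-1.
  by rewrite -ler_expR etau; have := expR_ge1Dx (2^-1 : R); lra.
pose t := Num.sqrt (2 * tau).
have t0 : 0 <= t by exact: sqrtr_ge0.
have t2 : t ^+ 2 = 2 * tau by rewrite sqr_sqrtr // mulr_ge0 // ltW.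
have t1 : t <= 1.
  by rewrite -(ler_pXn2r (n:=2)) // ?nnegrE // t2 expr1n; lra.
pose s := [seq k <- enum 'I_p | k != j].
have ss : size s = p.-1.
  rewrite size_filter -sum1_count big_enum_cond /= sum1_card.
  by have := cardC1 j; rewrite card_ord => <-; apply: eq_card.
have us : uniq s by rewrite filter_uniq // enum_uniq.
pose q := col_sqr j.
pose c w := t * q w `^ (- 2^-1).
have mq := @measurable_col_sqr j.
have mc : measurable_fun setT (c : subT Y (col_set n j) -> R).
  by apply: measurable_funM => //; exact: (measurableT_comp (measurable_powR _) mq).
pose A := q @^-1` `]0, +oo[%classic.
have mA : measurable (A : set (subT Y (col_set n j))).
  by rewrite -[X in measurable X]setTI; exact: mq.
pose Wf (x : T) (k : 'I_p) (y : T) : R := \sum_i (c x * Y (i, j) x) * Y (i, k) y.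
pose J2 : {set 'I_n * 'I_p} := finset (fun x => x.2 != j).
(* The indicator discards the outcomes with a vanishing column [j], where [Wf] is not Gaussian of
   variance [2 tau]. *)
pose F (z : subT Y (col_set n j) * subT Y J2) : R :=
  \1_A z.1 * expR (\sum_(k <- s) (100^-1 - Num.max 0 (Wf z.1 k z.2))).
have mcoord (J : {set 'I_n * 'I_p}) (k : 'I_n * 'I_p) :
    k \in J -> measurable_fun setT (Y k : subT Y J -> R).
  exact: measurable_entry_sub.
have mF : measurable_fun setT F.
  apply: measurable_funM.
    by apply: (measurableT_comp (measurable_indic mA)).
  apply: measurableT_comp => //.
  (* For [k = j] the summand need not be measurable in the second argument; it is set to 0 at that
     index, which does not occur in [s]. *)
  apply: (eq_measurable_fun (fun z : subT Y (col_set n j) * subT Y J2 => \sum_(k <- s)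
      (if k != j then 100^-1 - Num.max 0 (Wf z.1 k z.2) else 0))).
    by move=> z _; rewrite /s !big_filter; apply: eq_bigr => k ->.
  apply: measurable_sum => k; case: (boolP (k != j)) => //= kj.
  apply: measurable_funB => //; apply: measurable_maxr => //.
  apply: measurable_sum => i; apply: measurable_funM.
    apply: measurable_funM; first exact: (measurableT_comp mc).
    by apply: (measurableT_comp (mcoord (col_set n j) (i, j) _)) => //; rewrite inE.
  by apply: (measurableT_comp (mcoord J2 (i, k) _)) => //; rewrite inE.
have F0 z : 0 <= F z by rewrite mulr_ge0 ?expR_ge0.
have mD : measurable_fun setT (fun w : T => F (w, w)).
  apply: (measurableT_comp mF); apply: measurable_fun_pair;
    exact: (@measurable_id_subT _ _ _ _ _ Y).
apply: (@le_trans _ _ (\int[P]_w (F (w, w))%:E)%E).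
  apply: prob_le_integral => //; first exact: measurable_few_pos_dots.
  move=> w [q0 hw]; rewrite /F /= indicE mem_set /A /= ?in_itv /= ?andbT // mul1r.
  rewrite -[leLHS]expR0 ler_expR sumrB subr_ge0 big_const_seq count_predT ss iter_addr_0.
  apply: (@le_trans _ _ (pos_dots j w * q w `^ (- 2^-1))); last first.
    by apply: le_trans hw _; rewrite -[leRHS]mulr_natl.
  rewrite /pos_dots mulr_suml big_filter big_enum_cond; apply: ler_sum => k _.
  have -> : Wf w k w = c w * \sum_i Y (i, j) w * Y (i, k) w.
    by rewrite /Wf mulr_sumr; apply: eq_bigr => i _; rewrite mulrA.
  have [D0|D0] := leP 0 (\sum_i Y (i, j) w * Y (i, k) w).
    rewrite max_r ?mulr_ge0 ?powR_ge0 // mulrC ler_wpM2l //.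
    by rewrite /c ler_piMl ?powR_ge0.
  by rewrite max_l ?mul0r // mulr_ge0_le0 ?mulr_ge0 ?powR_ge0 // ltW.
rewrite (@indep_fubini _ _ _ _ _ Y indY (col_set n j) J2 (fun z => (F z)%:E)) //; last 2 first.
- apply/pred0P => i /=; apply/negP => /andP[]; rewrite !inE => /eqP ->.
  by rewrite eqxx.
- exact/measurable_EFinP.
apply: (@le_trans _ _ (\int[P]_w (expR (- (p.-1%:R / 50)))%:E)%E); last first.
  by rewrite integral_cst //= [X in (_ * X)%E]probability_setT mule1.
have mFw w : measurable_fun setT (fun w' : T => F (w, w')).
  apply: (measurableT_comp mF); apply: measurable_fun_pair => //.
  exact: (@measurable_id_subT _ _ _ _ _ Y).
apply: ge0_le_integral => //.
- by move=> w _; apply: integral_ge0 => w' _; rewrite lee_fin.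
- apply: (measurable_integral_subT (F := fun z => (F z)%:E)) => //.
  exact/measurable_EFinP.
move=> w _.
have [q0|q0] := ltP 0 (q w); last first.
  rewrite integral0_eq ?lee_fin ?expR_ge0 // => w' _.
  rewrite /F indicE memNset ?mul0r //= /A /= in_itv /= andbT.
  by apply/negP; rewrite -leNgt.
under eq_integral => w' _.
  rewrite /F /= indicE mem_set ?mul1r; last by rewrite /A /= in_itv /= andbT.
  rewrite expR_sum; over.
have mW k : measurable_fun setT (Wf w k : subT Y (col_set n k) -> R).
  apply: measurable_sum => i; apply: measurable_funM => //.
  by apply: mcoord; rewrite inE.
rewrite (indep_prod indY us (g := @col_set n p)
  (f := fun k w' => expR (100^-1 - Num.max 0 (Wf w k w')))) //; last 2 first.
- exact: disjoint_col.
- move=> k; apply: measurableT_comp => //; apply: measurable_funB => //.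
  exact: measurable_maxr.
rewrite (_ : - _ = p.-1%:R * (- 50^-1)); last by rewrite mulrN.
rewrite -ss; apply: prod_expR_le => k.
  by apply: integral_ge0 => y _; rewrite lee_fin expR_ge0.
have mWk := measurable_subT_fun (mW k).
under eq_integral do rewrite expRD EFinM.
rewrite ge0_integralZl_EFin ?expR_ge0 //; last first.
  apply/measurable_EFinP; do 2 apply: measurableT_comp => //.
  exact: measurable_maxr.
apply: (@le_trans _ _ ((expR 100^-1)%:E * (expR (- (3 / 100)))%:E)%E).
  apply: lee_pmul => //; rewrite ?lee_fin ?expR_ge0 //.
    by apply: integral_ge0 => y _; rewrite lee_fin expR_ge0.
  apply: (expectation_pos_part_le (tau := tau)) => // m.
  under eq_integral => y _.
    rewrite /Wf mulr_sumr.
    under eq_bigr => i _ do rewrite mulrA.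
    over.
  rewrite (mgf_column iidX); congr (expR _)%:E.
  under eq_bigr do rewrite !exprMn.
  rewrite -!mulr_sumr -/(q w).
  have -> : (q w `^ (- 2^-1)) ^+ 2 = (q w)^-1.
    by rewrite powRN powR12_sqrt ?ltW // exprVn sqr_sqrtr // ltW.
  rewrite t2 -[\sum_i _]/(q w); field.
  by rewrite gt_eqF.
rewrite -EFinM lee_fin -expRD ler_expR; lra.
Qed.
End positive_parts.

(** * Quadratic forms and symmetric matrices *)

Section forms.
Context (R : realType) (p : nat).
Implicit Types (A D Th : 'M[R]_p) (x y : 'cV[R]_p).

Definition bform A x y : R := (x^T *m A *m y) 0 0.
Definition sqn x : R := (x^T *m x) 0 0.

Lemma bformDl A x1 x2 y : bform A (x1 + x2) y = bform A x1 y + bform A x2 y.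
Proof. by rewrite /bform linearD /= !mulmxDl mxE. Qed.
Lemma bformDr A x y1 y2 : bform A x (y1 + y2) = bform A x y1 + bform A x y2.
Proof. by rewrite /bform mulmxDr mxE. Qed.
Lemma bformZl A a x y : bform A (a *: x) y = a * bform A x y.
Proof. by rewrite /bform linearZ /= -!scalemxAl mxE. Qed.
Lemma bformZr A a x y : bform A x (a *: y) = a * bform A x y.
Proof. by rewrite /bform -!scalemxAr mxE. Qed.
Lemma bform_addmx A D x y : bform (A + D) x y = bform A x y + bform D x y.
Proof. by rewrite /bform mulmxDr mulmxDl mxE. Qed.
Lemma bform_scalemx a A x y : bform (a *: A) x y = a * bform A x y.
Proof. by rewrite /bform -scalemxAr -scalemxAl mxE. Qed.
Lemma bform1 x : bform 1%:M x x = sqn x.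
Proof. by rewrite /bform mulmx1. Qed.
Lemma bformE A x y : bform A x y = \sum_i \sum_j x i 0 * A i j * y j 0.
Proof.
rewrite /bform mxE exchange_big /=; apply: eq_bigr => j _.
rewrite mxE mulr_suml; apply: eq_bigr => i _.
by rewrite mxE.
Qed.

Lemma bformT A x y : bform A^T x y = bform A y x.
Proof.
rewrite !bformE exchange_big; apply: eq_bigr => i _; apply: eq_bigr => j _.
by rewrite mxE mulrC mulrA mulrAC.
Qed.

Lemma sqnE x : sqn x = \sum_i x i 0 ^+ 2.
Proof. by rewrite /sqn mxE; apply: eq_bigr => i _; rewrite mxE expr2. Qed.

Lemma sqn_ge0 x : 0 <= sqn x.
Proof. by rewrite sqnE sumr_ge0 // => i _; exact: sqr_ge0. Qed.

Lemma sqn_eq0 x : sqn x = 0 -> x = 0.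
Proof.
move=> /eqP; rewrite sqnE psumr_eq0 => [/allP h|i _]; last exact: sqr_ge0.
apply/matrixP => i j; rewrite ord1 mxE; apply/eqP.
by have := h i (mem_index_enum _); rewrite /= sqrf_eq0.
Qed.

(** The form at [x + t y] is a nonnegative polynomial in [t] of degree at most 2. It is evaluated at
    its minimum when the leading coefficient is positive. *)
Lemma psd_cauchy A x y : sym_psd A -> bform A x y ^+ 2 <= bform A x x * bform A y y.
Proof.
move=> [sA pA].
have q0 z : 0 <= bform A z z by exact: pA.
have E t : bform A (x + t *: y) (x + t *: y) =
    bform A x x + 2 * t * bform A x y + t ^+ 2 * bform A y y.
  rewrite !(bformDl, bformDr, bformZl, bformZr) -[bform A y x]bformT sA; ring.
have [y0|y0] := eqVneq (bform A y y) 0.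
  have [-> |b0] := eqVneq (bform A x y) 0; first by rewrite expr0n /= mulr_ge0.
  (* At this vector the form would take the value -1. *)
  have := q0 (x + (- (bform A x x + 1) / (2 * bform A x y)) *: y).
  rewrite E y0 mulr0 addr0 (_ : 2 * _ * _ = - (bform A x x + 1)); last by field.
  by rewrite opprD addrA subrr add0r oppr_ge0 ler10.
have y1 : 0 < bform A y y by rewrite lt_def y0 q0.
have := q0 (x + (- bform A x y / bform A y y) *: y).
rewrite E (_ : _ + _ = bform A x x - bform A x y ^+ 2 / bform A y y); last by field.
by rewrite subr_ge0 ler_pdivrMr.
Qed.

Lemma coord_sqr_le x i : x i 0 ^+ 2 <= sqn x.
Proof. by rewrite sqnE (bigD1 i) //= lerDl sumr_ge0 // => k _; exact: sqr_ge0. Qed.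

Lemma bform_le A : exists2 C : R, 0 < C & forall x, `|bform A x x| <= C * sqn x.
Proof.
(* The summand 1 keeps the constant, a divisor later on, positive even for [A = 0]. *)
exists (1 + \sum_i \sum_j `|A i j|).
  by rewrite ltr_pwDl // sumr_ge0 // => i _; rewrite sumr_ge0.
move=> x; apply: (@le_trans _ _ ((\sum_i \sum_j `|A i j|) * sqn x)); last first.
  by rewrite ler_wpM2r ?sqn_ge0 // lerDr.
rewrite bformE mulr_suml; apply: le_trans (ler_norm_sum _ _ _) _.
apply: ler_sum => i _; rewrite mulr_suml; apply: le_trans (ler_norm_sum _ _ _) _.
apply: ler_sum => j _; rewrite !normrM mulrAC mulrC ler_wpM2l //.
have := coord_sqr_le x i; have := coord_sqr_le x j.
rewrite -(real_normK (num_real (x i 0))) -(real_normK (num_real (x j 0))).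
by have := sqr_ge0 (`|x i 0| - `|x j 0|); rewrite !expr2; nra.
Qed.

(* Cauchy-Schwarz for the form [Th] at [x] and [Th^-1 x], whose product is [|x|^2]. *)
Lemma pd_lower Th : sym_psd Th -> Th \in unitmx ->
  exists2 mu : R, 0 < mu & forall x, mu * sqn x <= bform Th x x.
Proof.
move=> psdT uT; have [sT _] := psdT.
have [C C0 hC] := bform_le (invmx Th).
exists C^-1; first by rewrite invr_gt0.
move=> x; have [x0|x0] := eqVneq (sqn x) 0.
  by rewrite x0 mulr0; case: psdT => _; exact.
have sx : 0 < sqn x by rewrite lt_def x0 sqn_ge0.
have := psd_cauchy x (invmx Th *m x) psdT.
have -> : bform Th x (invmx Th *m x) = sqn x.
  by rewrite /bform -mulmxA mulKVmx.
have -> : bform Th (invmx Th *m x) (invmx Th *m x) = bform (invmx Th) x x.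
  rewrite -[RHS]bformT {1}/bform trmx_mul -!mulmxA mulKVmx // mulmxA.
  by rewrite /bform.
move=> h; rewrite mulrC ler_pdivrMr // -(ler_pM2l sx) -expr2.
apply: le_trans h _; rewrite mulrCA; apply: ler_wpM2l; first by case: psdT => _; exact.
by rewrite mulrC; apply: le_trans (ler_norm _) (hC x).
Qed.

(** The form of [Th] is at least [mu |x|^2] and that of [D] at most [C |x|^2] in absolute value,
    whence [e = mu / C]. *)
Lemma sym_psd_open Th D : sym_psd Th -> Th \in unitmx -> D^T = D ->
  exists2 e : R, 0 < e & forall t, 0 <= t <= e -> sym_psd (Th + t *: D).
Proof.
move=> psdT uT sD; have [sT _] := psdT.
have [mu mu0 hmu] := pd_lower psdT uT; have [C C0 hC] := bform_le D.
exists (mu / C) => [|t /andP[t0 te]]; first exact: divr_gt0.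
split=> [|x]; first by rewrite linearD linearZ /= sT sD.
rewrite -[X in 0 <= X]/(bform (Th + t *: D) x x) bform_addmx bform_scalemx.
have := hmu x; have : t * `|bform D x x| <= mu * sqn x.
  apply: le_trans (ler_wpM2l t0 (hC x)) _; rewrite mulrA ler_wpM2r ?sqn_ge0 //.
  by rewrite -ler_pdivlMr.
have : - (t * bform D x x) <= t * `|bform D x x|.
  by rewrite -mulrN ler_wpM2l // -normrN ler_norm.
lra.
Qed.

Lemma psd1 : sym_psd (1%:M : 'M[R]_p).
Proof. by split=> [|x]; [rewrite trmx1|rewrite mulmx1; exact: sqn_ge0]. Qed.

Lemma pd_unit A (mu : R) :
  0 < mu -> (forall x, mu * sqn x <= bform A x x) -> A \in unitmx.
Proof.
move=> mu0 h; rewrite unitmxE unitfE; apply/negP => /det0P[v v0 vA].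
have := h v^T; rewrite /bform trmxK vA mul0mx [X in _ <= X]mxE => hle.
have /sqn_eq0 : sqn v^T = 0.
  by apply/eqP; rewrite eq_le sqn_ge0 andbT -(pmulr_rle0 _ mu0).
by move/(congr1 trmx); rewrite trmxK trmx0 => /eqP; rewrite (negPf v0).
Qed.

(* The matrices [(1 - s) 1 + s A], [0 <= s < 1], are positive definite, so their
   determinant, a polynomial in [s], does not vanish. *)
Lemma psd_det_ge0 A : sym_psd A -> 0 <= \det A.
Proof.
move=> [sA pA]; rewrite leNgt; apply/negP => dA.
pose P : {poly R} := \det ((1 - 'X) *: 1%:M + 'X *: map_mx polyC A).
have PE s : P.[s] = \det ((1 - s) *: 1%:M + s *: A).
  rewrite -horner_evalE -det_map_mx; congr (\det _); apply/matrixP => i j.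
  by rewrite !mxE /= !horner_evalE !hornerE /= hornerMn !hornerE.
have [|s /andP[s0 s1]] := @poly_ivt _ (- P) 0 1 ler01.
  rewrite !hornerN !PE subr0 subrr !(scale1r, scale0r) addr0 add0r det1.
  by rewrite oppr_le0 ler01 oppr_ge0 ltW.
rewrite rootE hornerN oppr_eq0 PE => /eqP ds.
have s1' : s < 1.
  rewrite lt_def s1 andbT; apply: contraTneq dA => s1'; move: ds.
  by rewrite -s1' subrr scale0r scale1r add0r => ->; rewrite ltxx.
suff : ((1 - s) *: 1%:M + s *: A) \in unitmx by rewrite unitmxE unitfE ds eqxx.
apply: (@pd_unit _ (1 - s)); first by rewrite subr_gt0.
move=> x; rewrite bform_addmx !bform_scalemx bform1 lerDl mulr_ge0 //.
exact: pA.
Qed.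

Lemma psd_det_gt0 A : sym_psd A -> \det A != 0 -> 0 < \det A.
Proof. by move=> /psd_det_ge0 d0 dn; rewrite lt_def dn. Qed.

(** Cauchy-Schwarz at unit vectors gives [A_ij^2 <= A_ii A_jj], and each diagonal entry is at most
    the trace. *)
Lemma entry_le_trace A i j : sym_psd A -> `|A i j| <= \tr A.
Proof.
move=> psdA; have [sA pA] := psdA.
have diagE k : bform A (delta_mx k 0) (delta_mx k 0) = A k k.
  by rewrite /bform trmx_delta -rowE -colE !mxE.
have d0 k : 0 <= A k k by rewrite -diagE; exact: pA.
have dt k : A k k <= \tr A.
  by rewrite /mxtrace (bigD1 k) //= lerDl sumr_ge0.
have := psd_cauchy (delta_mx i 0) (delta_mx j 0) psdA.
rewrite !diagE; rewrite /bform trmx_delta -rowE -colE !mxE => h.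
have t0 : 0 <= \tr A by apply: sumr_ge0.
rewrite -(ler_pXn2r (n:=2)) ?nnegrE // real_normK ?num_real //.
by apply: le_trans h _; rewrite expr2; apply: ler_pM.
Qed.

Lemma det_le_bound A (c : R) :
  (forall i j, `|A i j| <= c) -> `|\det A| <= p`!%:R * c ^+ p.
Proof.
move=> h; apply: le_trans (ler_norm_sum _ _ _) _.
rewrite -card_Sn mulr_natl -sumr_const; apply: ler_sum => s _.
rewrite normrM normrX normrN1 expr1n mul1r normr_prod.
by rewrite -[p in c ^+ p]card_ord -prodr_const ler_prod // => i _; rewrite normr_ge0 h.
Qed.

(* A column [x] of the inverse has [Th x >= 0]; pairing with the negative part of [x]
   forces the latter to vanish. *)
Lemma mmatrix_inv_ge0 Th : sym_psd Th -> Th \in unitmx ->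
  (forall j k, j != k -> Th j k <= 0) -> forall j k, 0 <= invmx Th j k.
Proof.
move=> psdT uT offT j k.
have [x xdef] : exists x : 'cV[R]_p, x = col k (invmx Th) by eexists.
have Tx : Th *m x = delta_mx k 0 by rewrite xdef colE mulmxA mulmxV // mul1mx.
pose pos : 'cV[R]_p := \col_i Num.max 0 (x i 0).
pose neg : 'cV[R]_p := \col_i Num.max 0 (- x i 0).
have xE : x = pos - neg.
  apply/matrixP => i l; rewrite ord1 !mxE; case: (lerP 0 (x i 0)) => h.
    have -> : Num.max 0 (- x i 0) = 0 by apply/max_idPl; rewrite oppr_le0.
    by rewrite subr0.
  have -> : Num.max 0 (- x i 0) = - x i 0 by apply/max_idPr; rewrite oppr_ge0 ltW.
  by rewrite sub0r opprK.
have neg0 i : 0 <= neg i 0 by rewrite mxE le_max lexx.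
have h1 : 0 <= bform Th neg x.
  by rewrite /bform -mulmxA Tx -colE !mxE le_max lexx.
have h2 : bform Th neg pos <= 0.
  rewrite bformE; apply: sumr_le0 => i _; apply: sumr_le0 => l _.
  have [<-|il] := eqVneq i l.
    rewrite !mxE; case: (lerP 0 (x i 0)) => h; last by rewrite mulr0.
    have -> : Num.max 0 (- x i 0) = 0 by apply/max_idPl; rewrite oppr_le0.
    by rewrite !mul0r.
  by rewrite mulrAC mulr_ge0_le0 ?offT // mulr_ge0 ?neg0 // mxE le_max lexx.
have [mu mu0 hmu] := pd_lower psdT uT.
have h3 : bform Th neg neg <= 0.
  move: h1; rewrite xE -[- neg]scaleN1r bformDr bformZr mulN1r; lra.
have /sqn_eq0 n0 : sqn neg = 0.
  apply/eqP; rewrite eq_le sqn_ge0 andbT -(pmulr_rle0 _ mu0).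
  exact: le_trans (hmu _) h3.
have -> : invmx Th j k = x j 0 by rewrite xdef mxE.
by rewrite xE n0 subr0 mxE le_max lexx.
Qed.
End forms.

(** * Expansion of the determinant at the identity; Rayleigh quotients *)

Section spectral.
Context (R : realType) (p : nat).
Implicit Types (A : 'M[R]_p) (x y : 'cV[R]_p).

Lemma char_poly_horner (F : comNzRingType) (m : nat) (M : 'M[F]_m) (x : F) :
  (char_poly M).[x] = \det (x%:M - M).
Proof.
rewrite /char_poly -horner_evalE -det_map_mx; congr (\det _).
apply/matrixP => i j; rewrite !mxE /= horner_evalE !hornerE /=.
by rewrite hornerMn hornerX.
Qed.

(* [det (1 + t M) = t^(m+1) chi (1 / t)] for the characteristic polynomial [chi] of [- M]. *)
Lemma det_id_add_lower (m : nat) (M : 'M[R]_m.+1) : exists2 C : R, 0 <= C &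
  forall t, 0 < t <= 1 -> 1 + t * \tr M - C * t ^+ 2 <= \det (1%:M + t *: M).
Proof.
set P := char_poly (- M).
exists (\sum_(i < m) `|P`_i|); first exact: sumr_ge0.
move=> t /andP[t0 t1]; have tn : t != 0 by rewrite gt_eqF.
have -> : \det (1%:M + t *: M) = t ^+ m.+1 * P.[t^-1].
  rewrite char_poly_horner -detZ opprK scalerDr; congr (\det (_ + _)).
  by rewrite scale_scalar_mx divff.
rewrite (@horner_coef_wide _ m.+2) ?size_char_poly // !big_ord_recr /=.
have -> : P`_m.+1 = 1.
  by have /monicP := char_poly_monic (- M); rewrite lead_coefE size_char_poly.
have -> : P`_m = \tr M.
  by have := @char_poly_trace _ _ (- M) isT; rewrite /= => ->; rewrite linearN opprK.
have e1 : t ^+ m.+1 * t^-1 ^+ m.+1 = 1 by rewrite exprVn divff ?expf_neq0.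
rewrite !mulrDr mul1r e1.
have -> : t ^+ m.+1 * (\tr M * t^-1 ^+ m) = t * \tr M.
  by rewrite exprVn exprS; field; rewrite expf_neq0.
suff : `|t ^+ m.+1 * \sum_(i < m) P`_i * t^-1 ^+ i| <= (\sum_(i < m) `|P`_i|) * t ^+ 2.
  by move=> /ler_normlP[]; lra.
rewrite mulr_sumr mulr_suml; apply: le_trans (ler_norm_sum _ _ _) _.
apply: ler_sum => i _.
rewrite mulrCA normrM ler_wpM2l //.
have -> : t ^+ m.+1 * t^-1 ^+ i = t ^+ 2 * t ^+ (m - i.+1).
  have -> : m.+1 = (2 + (m - i.+1) + i)%N.
    by rewrite -[in LHS](subnK (ltn_ord i)) addnS !addSn.
  by rewrite exprVn !exprD mulfK // expf_neq0.
rewrite normrM ger0_norm ?sqr_ge0 // ler_piMr ?sqr_ge0 //.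
by rewrite ger0_norm ?exprn_ge0 ?exprn_ile1 // ltW.
Qed.

(* The infimum [l] of the [x] with [x 1 - A] positive semidefinite is an eigenvalue:
   otherwise [l 1 - A] would be positive definite, and [l] could be decreased. *)
Lemma rayleigh_le_lambda_max A x : A^T = A -> 0 < sqn x ->
  bform A x x / sqn x <= lambda_max A.
Proof.
move=> sA x0; have [C C0 hC] := bform_le A.
have bformsub l y : bform (l%:M - A) y y = l * sqn y - bform A y y.
  by rewrite -scalemx1 -[- A]scaleN1r bform_addmx !bform_scalemx bform1 mulN1r.
pose E := [set l : R | sym_psd (l%:M - A)].
have symsub l : (l%:M - A)^T = l%:M - A by rewrite linearB /= tr_scalar_mx sA.
have EP l : E l <-> forall y, bform A y y <= l * sqn y.
  split=> [[_ h] y|h]; first by rewrite -subr_ge0 -bformsub; exact: h.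
  by split=> // y; rewrite -[X in 0 <= X]/(bform _ y y) bformsub subr_ge0.
have E0 : E !=set0.
  by exists C; apply/EP => y; exact: le_trans (ler_norm _) (hC y).
have Elb y : 0 < sqn y -> lbound E (bform A y y / sqn y).
  by move=> y0 l /EP h; rewrite ler_pdivrMr.
have hlb : has_lbound E by exists (bform A x x / sqn x); exact: Elb.
pose l := inf E.
have rl y : 0 < sqn y -> bform A y y / sqn y <= l.
  by move=> y0; apply: lb_le_inf => //; exact: Elb.
have El : E l.
  apply/EP => y; have [y0|y0] := eqVneq (sqn y) 0.
    by rewrite y0 mulr0 (sqn_eq0 y0) /bform mulmx0 mxE.
  by rewrite -ler_pdivrMr ?rl // lt_def y0 sqn_ge0.
have sing : l%:M - A \notin unitmx.
  apply/negP => u; have [|e e0 he] := sym_psd_open El u (D := - 1%:M).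
    by rewrite linearN /= trmx1.
  have : E (l - e).
    have := he e; rewrite lexx (ltW e0) => /(_ isT); rewrite /E /=.
    have -> : (l - e)%:M = l%:M - e%:M :> 'M[R]_p.
      by apply/matrixP => i j; rewrite !mxE mulrnBl.
    by rewrite scalerN scalemx1 addrAC.
  by move=> /(ge_inf hlb); rewrite -/l; lra.
apply: (le_trans (rl x x0)); apply: ub_le_sup.
  (* The supremum in [lambda_max] needs an upper bound: an eigenvalue is the Rayleigh quotient of
     its eigenvector, hence at most [C]. *)
  exists C => a /eigenvalueP[v vA v0].
  have sv : 0 < sqn v^T.
    rewrite lt_def sqn_ge0 andbT; apply: contraNneq v0 => /sqn_eq0.
    by move/(congr1 trmx); rewrite trmxK trmx0 => ->.
  rewrite -(ler_pM2r sv); apply: le_trans (ler_norm _) _.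
  have := hC v^T; rewrite /bform trmxK vA -scalemxAl mxE.
  by rewrite -[X in `|a * X|]/((v *m v^T) 0 0) /sqn trmxK.
rewrite /=; apply/eigenvalueP.
move: sing; rewrite unitmxE unitfE negbK => /det0P[v v0 vl]; exists v => //.
by apply/eqP; rewrite -subr_eq0 -opprB oppr_eq0 -mul_mx_scalar -mulmxBr vl.
Qed.
End spectral.

(** * Maximum likelihood *)

Section likelihood.
Context (R : realType) (p : nat).
Implicit Types (S Th D : 'M[R]_p).

(** The exponential of minus the objective on positive semidefinite matrices. It is real-valued,
    continuous and 0 at singular matrices, so the extreme value theorem applies up to the boundary
    of the cone. *)
Definition likelihood S Th : R := \det Th * expR (- frob Th S).

Lemma frobE Th S : frob Th S = \sum_i \sum_j Th i j * S i j.
Proof.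
rewrite /frob /mxtrace exchange_big; apply: eq_bigr => j _.
by rewrite mxE; apply: eq_bigr => i _; rewrite mxE.
Qed.

Lemma Mset1 : Mset (1%:M : 'M[R]_p).
Proof.
by split; [exact: psd1|move=> j k jk; rewrite mxE (negPf jk)].
Qed.

Lemma likelihood_ge0 S Th : Mset Th -> 0 <= likelihood S Th.
Proof. by move=> [pT _]; rewrite mulr_ge0 ?expR_ge0 ?psd_det_ge0. Qed.

Lemma likelihood1 S : likelihood S 1%:M = expR (- \tr S).
Proof. by rewrite /likelihood det1 mul1r /frob trmx1 mul1mx. Qed.

Lemma objective_likelihood S Th : Mset Th -> \det Th != 0 ->
  objective S Th = (- ln (likelihood S Th))%:E.
Proof.
move=> [pT _] d0; rewrite /objective /neg_logdet (negPf d0) -EFinD; congr (_%:E).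
have dT := psd_det_gt0 pT d0.
by rewrite /likelihood lnM ?posrE ?expR_gt0 // expRK opprD opprK addrC.
Qed.

(** A minimizer is nonsingular because the objective is finite at the identity; between nonsingular
    matrices the monotonicity of [ln] translates the comparison. *)
Lemma argmin_likelihoodP S Th : argmin_set S Th <->
  [/\ Mset Th, 0 < \det Th & forall Th', Mset Th' -> likelihood S Th' <= likelihood S Th].
Proof.
split=> [[MT hT]|[MT d0 hT]]; last first.
  split=> // Th' MT'.
  have [d'0|d'0] := eqVneq (\det Th') 0.
    by rewrite [leRHS]/objective /neg_logdet d'0 eqxx addey ?leey.
  have dn : \det Th != 0 by rewrite gt_eqF.
  rewrite (objective_likelihood S MT dn) (objective_likelihood S MT' d'0) lee_fin lerN2.
  rewrite ler_ln ?posrE; first exact: hT.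
    by rewrite mulr_gt0 ?expR_gt0 // psd_det_gt0 //; case: MT'.
  by rewrite mulr_gt0 ?expR_gt0.
have d0 : \det Th != 0.
  apply/eqP => dT; have := hT _ Mset1.
  rewrite [X in (X <= _)%E]/objective /neg_logdet dT eqxx addey //.
  by rewrite objective_likelihood ?det1 ?oner_eq0 //; exact: Mset1.
have dT : 0 < \det Th by case: MT => pT _; exact: psd_det_gt0.
split=> // Th' MT'.
have [d'0|d'0] := eqVneq (\det Th') 0.
  by rewrite [leLHS]/likelihood d'0 mul0r likelihood_ge0.
have := hT _ MT'.
rewrite (objective_likelihood S MT d0) (objective_likelihood S MT' d'0) lee_fin lerN2.
rewrite ler_ln ?posrE //.
  by rewrite mulr_gt0 ?expR_gt0 // psd_det_gt0 //; case: MT'.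
by rewrite mulr_gt0 ?expR_gt0.
Qed.

(** Off the diagonal [Th_jk S_jk >= b Th_jk], so that [<Th, S>] is at least
    [(a - b) tr Th + b 1^T Th 1], whose last term is nonnegative. *)
Lemma frob_ge_trace S Th (a b : R) : Mset Th -> 0 <= b ->
  (forall j, a <= S j j) -> (forall j k, j != k -> S j k <= b) ->
  (a - b) * \tr Th <= frob Th S.
Proof.
move=> [psdT offT] b0 ha hb; have [sT pT] := psdT.
have diag0 j : 0 <= Th j j.
  by have := pT (delta_mx j 0); rewrite trmx_delta -rowE -colE !mxE.
pose one : 'cV[R]_p := const_mx 1.
have h1 : 0 <= b * bform Th one one by rewrite mulr_ge0 //; exact: pT.
rewrite bformE in h1; rewrite frobE.
suff : (a - b) * \tr Th + b * (\sum_i \sum_j one i 0 * Th i j * one j 0) <=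
    \sum_i \sum_j Th i j * S i j by lra.
rewrite /mxtrace !mulr_sumr -big_split /=; apply: ler_sum => i _.
rewrite mulr_sumr (bigD1 i) //= [leRHS](bigD1 i) //= addrA; apply: lerD.
  by rewrite !mxE mul1r mulr1 -mulrDl subrK mulrC ler_wpM2l.
apply: ler_sum => j ji; rewrite !mxE mul1r mulr1 mulrC.
by rewrite ler_wnM2l ?hb ?offT // eq_sym.
Qed.

(** Since [exp (c t) >= (c t / (p + 1))^(p + 1)], the exponential wins one power of [t] over the
    bound [p! t^p] on the determinant. *)
Lemma det_mul_expR_small (c y : R) (t : R) : 0 < c -> 0 < y ->
  p`!%:R * (p.+1%:R / c) ^+ p.+1 / y <= t -> 0 < t ->
  p`!%:R * t ^+ p * expR (- (c * t)) <= y.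
Proof.
move=> c0 y0 ht t0; rewrite expRN ler_pdivrMr ?expR_gt0 //.
have e : c * t = p.+1%:R * (c * t / p.+1%:R) by rewrite [RHS]mulrC divfK ?pnatr_eq0.
have q0 : 0 < c * t / p.+1%:R by rewrite divr_gt0 ?mulr_gt0 ?ltr0n.
apply: (@le_trans _ _ (y * (c * t / p.+1%:R) ^+ p.+1)); last first.
  rewrite ler_pM2l // [in leRHS]e expRM_natl ler_pXn2r ?nnegrE ?expR_ge0 ?(ltW q0) //.
  by apply: le_trans _ (expR_ge1Dx _); rewrite lerDr.
have -> : c * t / p.+1%:R = t * (p.+1%:R / c)^-1 by rewrite invf_div; ring.
have r0 : 0 < (p.+1%:R / c) ^+ p.+1 by rewrite exprn_gt0 // divr_gt0 ?ltr0n.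
rewrite exprMn exprVn mulrA ler_pdivlMr // [t ^+ p.+1]exprS.
move: ht; rewrite ler_pdivrMr // => ht.
have := ler_wpM2r (ltW (exprn_gt0 p t0)) ht.
set u := p`!%:R; set v := (_ / c) ^+ _; set w := t ^+ p => h.
apply: (@le_trans _ _ (u * v * w)); first by rewrite mulrAC.
by rewrite (le_trans h) // le_eqVlt; apply/orP; left; apply/eqP; ring.
Qed.
End likelihood.

(** * Existence of the minimizer by compactness *)

Section mle.
Context (R : realType) (p : nat).
Implicit Types (S Th D : 'M[R]_p).

Lemma continuous_sumr (T : topologicalType) (I : Type) (r : seq I) (P : pred I)
  (F : I -> T -> R) : (forall i, P i -> continuous (F i)) ->
  continuous (fun x => \sum_(i <- r | P i) F i x).
Proof. by move=> cF; apply: continuous_big => //; exact: add_continuous. Qed.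

Lemma continuous_prodr (T : topologicalType) (I : Type) (r : seq I) (P : pred I)
  (F : I -> T -> R) : (forall i, P i -> continuous (F i)) ->
  continuous (fun x => \prod_(i <- r | P i) F i x).
Proof. by move=> cF; apply: continuous_big => //; exact: mul_continuous. Qed.

Lemma continuous_vec_mx (i j : 'I_p) :
  continuous (fun v : 'rV[R]_(p * p) => vec_mx v i j).
Proof.
rewrite (_ : (fun v => _) = fun v : 'rV[R]_(p * p) => v 0 (mxvec_index i j)).
  exact: coord_continuous.
by apply/funext => v; rewrite mxE.
Qed.

Lemma continuous_mulr (T : topologicalType) (f g : T -> R) :
  continuous f -> continuous g -> continuous (fun x => f x * g x).
Proof. by move=> cf cg x; apply: cvgM; [exact: cf|exact: cg]. Qed.

Lemma continuous_cst (T : topologicalType) (c : R) : continuous (fun _ : T => c).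
Proof. by move=> x; exact: cvg_cst. Qed.

Lemma continuous_oppr (T : topologicalType) (f : T -> R) :
  continuous f -> continuous (fun x => - f x).
Proof. by move=> cf x; apply: (@cvgN _ R^o); exact: cf. Qed.

Lemma continuous_subr (T : topologicalType) (f g : T -> R) :
  continuous f -> continuous g -> continuous (fun x => f x - g x).
Proof. by move=> cf cg x; apply: (@cvgB _ R^o); [exact: cf|exact: cg]. Qed.

Lemma closed_ge0 (T : topologicalType) (f : T -> R) : continuous f ->
  closed [set x | 0 <= f x].
Proof. by move=> /continuous_closedP cf; exact: (cf _ (@closed_ge R 0)). Qed.

Lemma continuous_likelihood S :
  continuous (fun v : 'rV[R]_(p * p) => likelihood S (vec_mx v)).
Proof.
apply: continuous_mulr.
  apply: continuous_sumr => s _; apply: continuous_mulr; first exact: continuous_cst.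
  by apply: continuous_prodr => i _; exact: continuous_vec_mx.
move=> v; apply: continuous_comp; last exact: continuous_expR.
apply: continuous_oppr => {}v.
under eq_fun do rewrite frobE.
move: v; apply: continuous_sumr => i _; apply: continuous_sumr => j _.
by apply: continuous_mulr; [exact: continuous_vec_mx|exact: continuous_cst].
Qed.

(** Each condition is a family of inequalities [0 <= f] with [f] continuous. Matrices are flattened
    to row vectors, for which [bounded_closed_compact] is available. *)
Lemma closed_Mset_trace (C : R) :
  closed [set v : 'rV[R]_(p * p) | Mset (vec_mx v) /\ \tr (vec_mx v) <= C].
Proof.
pose c1 := [set v : 'rV[R]_(p * p) | forall i j, 0 <= vec_mx v i j - vec_mx v j i].
pose c2 := [set v : 'rV[R]_(p * p) | forall x, 0 <= bform (vec_mx v) x x].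
pose c3 := [set v : 'rV[R]_(p * p) | forall i j, i != j -> 0 <= - vec_mx v i j].
pose c4 := [set v : 'rV[R]_(p * p) | 0 <= C - \tr (vec_mx v)].
rewrite (_ : mkset _ = c1 `&` (c2 `&` (c3 `&` c4))); last first.
  apply/seteqP; split=> v /=.
    move=> [[[sv pv] offv] tv]; split; last split; last split.
    - move=> i j; have /= := congr1 (fun M : 'M[R]_p => M i j) sv.
      by rewrite [X in X = _]mxE => ->; rewrite subrr.
    - exact: pv.
    - by move=> i j ij; rewrite oppr_ge0 offv.
    - by rewrite /c4 /= subr_ge0.
  move=> [v1 [v2 [v3 v4]]]; split; last by rewrite -subr_ge0.
  split; last by move=> i j ij; rewrite -oppr_ge0 v3.
  split; last exact: v2.
  apply/matrixP => i j; rewrite mxE; apply/eqP; rewrite eq_le.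
  by rewrite -subr_ge0 v1 -subr_ge0 v1.
have closed_forall (I : Type) (f : I -> 'rV[R]_(p * p) -> R) :
    (forall i, continuous (f i)) -> closed [set v | forall i, 0 <= f i v].
  move=> cf; rewrite (_ : mkset _ = \bigcap_(i in setT) [set v | 0 <= f i v]).
    by apply: closed_bigI => i _; exact: closed_ge0.
  by apply/seteqP; split=> v /= h i => [_|]; apply: h.
have cvm := continuous_vec_mx.
have cN := continuous_oppr.
apply: closedI; [|apply: closedI; [|apply: closedI]].
- rewrite (_ : c1 = [set v | forall ij : 'I_p * 'I_p,
      0 <= vec_mx v ij.1 ij.2 - vec_mx v ij.2 ij.1]); last first.
    by apply/seteqP; split=> v /= h; [move=> [i j]; exact: h|move=> i j; exact: (h (i, j))].
  apply: closed_forall => -[i j].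
  by apply: continuous_subr; exact: cvm.
- apply: closed_forall => x.
  rewrite (_ : (fun v => _) =
      fun v => \sum_i \sum_j x i 0 * vec_mx v i j * x j 0); last first.
    by apply/funext => v; rewrite bformE.
  apply: continuous_sumr => i _; apply: continuous_sumr => j _.
  apply: continuous_mulr; last exact: continuous_cst.
  by apply: continuous_mulr; first exact: continuous_cst.
- rewrite (_ : c3 = [set v | forall ij : {ij : 'I_p * 'I_p | ij.1 != ij.2},
      0 <= - vec_mx v (val ij).1 (val ij).2]); last first.
    apply/seteqP; split=> v /= h; first by move=> [[i j] ij]; exact: h.
    by move=> i j ij; exact: (h (exist _ (i, j) ij)).
  by apply: closed_forall => ij; apply: cN.
- apply: closed_ge0; apply: continuous_subr; first exact: continuous_cst.
  by apply: continuous_sumr => i _; exact: cvm.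
Qed.

Lemma bounded_Mset_trace (C : R) :
  bounded_set [set v : 'rV[R]_(p * p) | Mset (vec_mx v) /\ \tr (vec_mx v) <= C].
Proof.
exists (Num.max 0 C); split; first exact: num_real.
move=> x Cx v [[psdv _] tv].
have x0 : 0 <= x by rewrite ltW // (le_lt_trans _ Cx) // le_max lexx.
rewrite /Num.norm /= mx_normrE; apply: bigmax_le => // -[i k] _ /=.
rewrite ord1; case/mxvec_indexP: k => a b.
have -> : v 0 (mxvec_index a b) = vec_mx v a b by rewrite mxE.
apply: le_trans (entry_le_trace a b psdv) _; apply: le_trans tv _.
by rewrite ltW // (le_lt_trans _ Cx) // le_max lexx orbT.
Qed.

(* The likelihood is maximal on the compact set of the [Th] of trace at most [C], for
   [C] so large that outside it is below its value at the identity. *)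
Lemma argmin_nonempty S (a b : R) : 0 <= b < a ->
  (forall j, a <= S j j) -> (forall j k, j != k -> S j k <= b) ->
  exists Th, argmin_set S Th.
Proof.
move=> /andP[b0 ba] ha hb.
pose c := a - b; have c0 : 0 < c by rewrite subr_gt0.
pose y := expR (- \tr S); have y0 : 0 < y by exact: expR_gt0.
pose C0 := p`!%:R * (p.+1%:R / c) ^+ p.+1 / y : R.
have C00 : 0 <= C0.
  by rewrite /C0 divr_ge0 ?(ltW y0) // mulr_ge0 // exprn_ge0 // divr_ge0 // ltW.
(* The term [p] is the trace of the identity and puts the latter in [K]. *)
pose C := C0 + p%:R.
pose K := [set v : 'rV[R]_(p * p) | Mset (vec_mx v) /\ \tr (vec_mx v) <= C].
have cK : compact K.
  by apply: bounded_closed_compact; [exact: bounded_Mset_trace|exact: closed_Mset_trace].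
have K1 : K (mxvec 1%:M).
  by rewrite /K /= mxvecK; split; [exact: Mset1|rewrite mxtrace1 lerDr].
have [] := @compact_EVT_max _ _ (fun v => likelihood S (vec_mx v)) K _ cK _.
- by exists (mxvec 1%:M).
- by apply: continuous_subspaceT; exact: continuous_likelihood.
move=> v vK hv; exists (vec_mx v); apply/argmin_likelihoodP.
have [Mv tv] : K v by rewrite inE in vK.
have h1 : y <= likelihood S (vec_mx v).
  by have := hv _ (mem_set K1); rewrite mxvecK likelihood1.
have dv : 0 < \det (vec_mx v).
  case: (Mv) => pv _; apply: psd_det_gt0 => //; apply: contraTneq h1 => d0.
  by rewrite /likelihood d0 mul0r -ltNge.
split=> // Th MT.
have [tT|tT] := leP (\tr Th) C.
  have KT : K (mxvec Th) by rewrite /K /= mxvecK.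
  by have := hv _ (mem_set KT); rewrite mxvecK.
(* Outside [K] the likelihood is at most [p! t^p exp (- (a - b) t)], hence at most its value [y] at
   the identity. *)
apply: le_trans h1; set t := \tr Th in tT.
have t0 : 0 < t by rewrite (le_lt_trans _ tT) // addr_ge0.
have tC : C0 <= t by rewrite ltW // (le_lt_trans _ tT) // lerDl.
apply: le_trans (det_mul_expR_small c0 y0 tC t0).
rewrite /likelihood; apply: ler_pM; rewrite ?expR_ge0 //.
- by case: (MT) => pT _; exact: psd_det_ge0.
- apply: le_trans (ler_norm _) _; apply: det_le_bound => i j.
  by case: (MT) => pT _; exact: entry_le_trace.
- by rewrite ler_expR lerN2; exact: frob_ge_trace.
Qed.

End mle.

(** * First-order optimality conditions *)

Section kkt.
Context (R : realType) (p : nat).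
Implicit Types (S Th D : 'M[R]_p.+1).

(** Comparison of first-order terms at [t = 0] without derivatives: multiplying by
    [1 - t delta <= exp (- t delta)] bounds [t (tau - delta)] by a multiple of [t^2]. *)
Lemma expR_dominates_line (e C tau delta : R) : 0 < e -> 0 <= C ->
  (forall t, 0 < t <= e -> 1 + t * tau - C * t ^+ 2 <= expR (t * delta)) ->
  tau <= delta.
Proof.
move=> e0 C0 h; rewrite leNgt; apply/negP => dt.
pose K := C + `|tau * delta| + C * `|delta| + 1.
have K0 : 0 < K by rewrite ltr_wpDl // !addr_ge0 // mulr_ge0.
pose g := tau - delta; have g0 : 0 < g by rewrite subr_gt0.
(* Small enough for [t K <= g / 2], which will contradict [g <= t K], and for [1 - t delta >= 0]. *)
pose t := Num.min (Num.min e 1) (Num.min (g / (2 * K)) (1 / (`|delta| + 1))).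
have d1 : 0 < `|delta| + 1 by rewrite ltr_wpDl.
have t0 : 0 < t by rewrite !lt_min e0 ltr01 !divr_gt0 // mulr_gt0.
have te : t <= e by rewrite !ge_min lexx.
have t1 : t <= 1 by rewrite !ge_min lexx orbT.
have tK : t * (2 * K) <= g by rewrite -ler_pdivlMr ?mulr_gt0 // !ge_min lexx !orbT.
have td : t * (`|delta| + 1) <= 1 by rewrite -ler_pdivlMr // !ge_min lexx !orbT.
have td1 : 0 <= 1 - t * delta.
  have := ler_wpM2l (ltW t0) (ler_norm delta); lra.
have h1 : (1 + t * tau - C * t ^+ 2) * (1 - t * delta) <= 1.
  apply: (@le_trans _ _ (expR (t * delta) * (1 - t * delta))).
    by rewrite ler_wpM2r // h // t0.
  apply: (@le_trans _ _ (expR (t * delta) * expR (- (t * delta)))).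
    by rewrite ler_wpM2l ?expR_ge0 // expR_ge1Dx.
  by rewrite expRN divff // gt_eqF ?expR_gt0.
have h2 : t * g <= t * (t * K).
  have E : (1 + t * tau - C * t ^+ 2) * (1 - t * delta) - 1 =
    t * g - t * (t * (C + tau * delta - t * (C * delta))) by rewrite /g; ring.
  have : t * (t * (C + tau * delta - t * (C * delta))) <= t * (t * K).
    rewrite !ler_wpM2l ?(ltW t0) // /K.
    have := ler_norm (tau * delta).
    have : - (t * (C * delta)) <= C * `|delta|.
      rewrite mulrCA -mulrN ler_wpM2l // (le_trans (ler_norm _)) // normrN normrM.
      by rewrite gtr0_norm // ler_piMl.
    lra.
  lra.
move: h2; rewrite ler_pM2l // => h2; lra.
Qed.

(** As [Th] is positive definite, [Th + t D] is feasible for small [t > 0]. Maximality of the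
    likelihood reads [det (1 + t Th^-1 D) <= exp (t <D, S>)], and the first-order terms are
    compared. *)
Lemma argmin_stationary S Th D : argmin_set S Th -> D^T = D ->
  (forall j k, j != k -> D j k <= 0) -> \tr (invmx Th *m D) <= frob D S.
Proof.
move=> /argmin_likelihoodP[[pT oT] dT hT] sD oD.
have uT : Th \in unitmx by rewrite unitmxE unitfE gt_eqF.
have [e e0 he] := sym_psd_open pT uT sD.
have [C C0 hC] := det_id_add_lower (invmx Th *m D).
apply: (@expR_dominates_line (Num.min e 1) C) => //; first by rewrite lt_min e0 ltr01.
move=> t /andP[t0]; rewrite le_min => /andP[te t1].
apply: le_trans (hC t _) _; first by rewrite t0.
have Mt : Mset (Th + t *: D).
  split; first by apply: he; rewrite (ltW t0).
  move=> j k jk; rewrite !mxE; have := oT j k jk; have := oD j k jk => d1 d2.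
  by have := ler_wpM2l (ltW t0) d1; rewrite mulr0; lra.
have := hT _ Mt; rewrite /likelihood.
have -> : frob (Th + t *: D) S = frob Th S + t * frob D S.
  by rewrite /frob linearD linearZ /= mulmxDl -scalemxAl mxtraceD mxtraceZ.
have -> : \det (Th + t *: D) = \det Th * \det (1%:M + t *: (invmx Th *m D)).
  by rewrite -det_mulmx mulmxDr mulmx1 -scalemxAr mulKVmx.
rewrite -mulrA ler_pM2l // opprD expRD [expR (- frob Th S) * _]mulrC mulrA.
rewrite -[leRHS]mul1r ler_pM2r ?expR_gt0 // [expR (- _)]expRN.
by rewrite ler_pdivrMr ?expR_gt0 // mul1r.
Qed.

Lemma lambda_max_Sigma_hat S (a b : R) : S^T = S -> 0 <= b < a ->
  (forall j, a <= S j j) -> (forall j k, j != k -> S j k <= b) ->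
  (\sum_j (S j j + \sum_(k | k != j) Num.max 0 (S j k))) / p.+1%:R <=
  lambda_max (Sigma_hat S).
Proof.
move=> sS ab ha hb.
have [Th0 aTh0] := argmin_nonempty ab ha hb.
rewrite /Sigma_hat; set Th := Theta_hat S.
have aTh : argmin_set S Th by rewrite /Th /Theta_hat; exact: xgetI aTh0.
have [[pT oT] dT _] := (argmin_likelihoodP _ _).1 aTh.
have uT : Th \in unitmx by rewrite unitmxE unitfE gt_eqF.
have iT := mmatrix_inv_ge0 pT uT oT.
pose B : 'M[R]_p.+1 := \matrix_(j, k) ((j == k) || (0 < S j k))%:R.
have sB : (- B)^T = - B.
  apply/matrixP => i j; rewrite !mxE eq_sym; congr (- ((_ || (0 < _)))%:R).
  by rewrite -[in RHS]sS mxE.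
have oB j k : j != k -> (- B) j k <= 0 by move=> _; rewrite !mxE oppr_le0 ler0n.
have := argmin_stationary aTh sB oB.
rewrite mulmxN linearN /= frobE.
under [X in _ <= X]eq_bigr do under eq_bigr do rewrite mxE mulNr.
under [X in _ <= X]eq_bigr do rewrite sumrN.
rewrite sumrN lerN2 => hB.
pose one : 'cV[R]_p.+1 := const_mx 1.
have sq1 : sqn one = p.+1%:R.
  rewrite sqnE (eq_bigr (fun=> 1)) => [|i _]; last by rewrite mxE expr1n.
  by rewrite sumr_const card_ord.
have s1 : 0 < sqn one by rewrite sq1 ltr0n.
have sI : (invmx Th)^T = invmx Th by rewrite trmx_inv; case: pT => ->.
apply: le_trans (rayleigh_le_lambda_max sI s1); rewrite sq1 ler_pM2r ?invr_gt0 ?ltr0n //.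
apply: (@le_trans _ _ (\sum_i \sum_j B i j * S i j)).
  apply: ler_sum => j _; rewrite [leRHS](bigD1 j) //= mxE eqxx mul1r lerD2l.
  apply: ler_sum => k kj; rewrite mxE eq_sym (negPf kj) /=.
  by case: (ltrP 0 (S j k)) => h; rewrite ?mul1r ?mul0r.
(* Entrywise nonnegativity of [invmx Th] bounds its pairing with the 0/1 matrix [B] by the sum of
   all its entries. *)
apply: le_trans hB _; rewrite bformE /mxtrace; apply: ler_sum => i _.
rewrite mxE; apply: ler_sum => j _; rewrite !mxE mul1r mulr1.
by case: (_ || _); rewrite ?mulr1 ?mulr0 ?iT.
Qed.
End kkt.

Lemma lambda_max_Sigma_hat_lower (R : realType) (p : nat) (S : 'M[R]_p) (a b : R) :
  (0 < p)%N -> S^T = S -> 0 <= b < a ->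
  (forall j, a <= S j j) -> (forall j k, j != k -> S j k <= b) ->
  (\sum_j (S j j + \sum_(k | k != j) Num.max 0 (S j k))) / p%:R <=
  lambda_max (Sigma_hat S).
Proof. by case: p S => // p S _; exact: lambda_max_Sigma_hat. Qed.

(** * The good event *)

Section main.
Context (R : realType) d (T : measurableType d) (P : probability T R).

Lemma seq_bigcup_cons (I : eqType) (i : I) (s : seq I) (F : I -> set T) :
  [set w | exists2 k, k \in i :: s & F k w] =
  F i `|` [set w | exists2 k, k \in s & F k w].
Proof.
apply/seteqP; split=> w /=.
  by move=> [k]; rewrite inE => /predU1P[->|ks] Fk; [left|right; exists k].
move=> [Fi|[k ks Fk]]; first by exists i; rewrite ?mem_head.
by exists k; rewrite // inE ks orbT.
Qed.

Lemma measurable_seq_bigcup (I : eqType) (s : seq I) (F : I -> set T) :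
  (forall i, measurable (F i)) -> measurable [set w | exists2 i, i \in s & F i w].
Proof.
move=> mF; elim: s => [|i s IH].
  rewrite (_ : mkset _ = set0) //; apply/seteqP; split=> w //= -[i].
  by rewrite in_nil.
by rewrite seq_bigcup_cons; exact: measurableU.
Qed.

Lemma union_bound (I : eqType) (s : seq I) (F : I -> set T) (c : R) :
  (forall i, measurable (F i)) -> (forall i, P (F i) <= c%:E)%E ->
  (P [set w | exists2 i, i \in s & F i w] <= ((size s)%:R * c)%:E)%E.
Proof.
move=> mF Fc; elim: s => [|i s IH].
  rewrite (_ : mkset _ = set0) ?measure0 ?mul0r //; apply/seteqP; split=> w //= -[i].
  by rewrite in_nil.
rewrite seq_bigcup_cons; apply: le_trans (measureU2 _ _ _) _ => //.
  exact: measurable_seq_bigcup.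
by rewrite /= -natr1 mulrDl mul1r addrC EFinD leeD.
Qed.

Section good_event.
Context (n p : nat) (X : 'I_n -> {RV P >-> p.-tuple R}).
Local Notation Y := (entry X).

Lemma sample_cov_entry w j k :
  sample_cov (data_matrix X w) j k = n%:R^-1 * \sum_i Y (i, j) w * Y (i, k) w.
Proof.
rewrite /sample_cov !mxE; congr (_ * _); apply: eq_bigr => i _.
by rewrite !mxE.
Qed.

Lemma sample_cov_sym w : (sample_cov (data_matrix X w))^T = sample_cov (data_matrix X w).
Proof. by rewrite /sample_cov linearZ /= trmx_mul trmxK. Qed.

Definition short_col (j : 'I_p) : set T :=
  [set w | \sum_(k <- col_seq n j) Y k w ^+ 2 <= n%:R * (1 - 4^-1)].
(** Empty on the diagonal, so that the union bound can run over all pairs. *)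
Definition large_dot (jk : 'I_p * 'I_p) : set T :=
  if jk.1 == jk.2 then set0
  else [set w | n%:R / 2 <= \sum_i Y (i, jk.1) w * Y (i, jk.2) w].
Definition small_trace (eta : R) : set T :=
  [set w | \sum_(k <- enum {: 'I_n * 'I_p}) Y k w ^+ 2 <= (n * p)%:R * (1 - eta)].

Lemma col_sqrE j w : col_sqr X j w = \sum_(k <- col_seq n j) Y k w ^+ 2.
Proof. by rewrite big_map big_enum. Qed.

(** The deterministic part. The diagonal of [S] is at least 3/4 and the other entries at most 1/2,
    so [lambda_max_Sigma_hat_lower] applies. As [|X_j| >= (4/5) sqrt n], each row gains
    [(p - 1) / (125 sqrt n)], while the trace loses at most [eta] per row. *)
Lemma lambda_max_good w : (0 < n)%N -> (1 < p)%N ->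
  (forall j, ~ short_col j w) -> (forall jk, ~ large_dot jk w) ->
  (forall j, ~ few_pos_dots X j w) ->
  ~ small_trace (500^-1 * (p%:R / Num.sqrt n%:R)) w ->
  1 + 500^-1 * (p%:R / Num.sqrt n%:R) <=
  lambda_max (Sigma_hat (sample_cov (data_matrix X w))).
Proof.
move=> n0 p1; have nR : 0 < n%:R :> R by rewrite ltr0n.
have pR : 2 <= p%:R :> R by rewrite (ler_nat R 2).
set r := Num.sqrt n%:R; have r0 : 0 < r by rewrite sqrtr_gt0.
have r2 : r * r = n%:R by rewrite -expr2 sqr_sqrtr // ltW.
set eta := 500^-1 * (p%:R / r).
move=> h1 h2 h3 h4.
have q1 j : n%:R * (3 / 4) < col_sqr X j w.
  by have /negP := h1 j; rewrite -ltNge col_sqrE; lra.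
set S := sample_cov _.
have SE j k : S j k = n%:R^-1 * \sum_i Y (i, j) w * Y (i, k) w by exact: sample_cov_entry.
have Sjj j : S j j = n%:R^-1 * col_sqr X j w.
  by rewrite SE; congr (_ * _); apply: eq_bigr => i _; rewrite expr2.
have ha j : 3 / 4 <= S j j.
  by rewrite Sjj ler_pdivlMl // ltW.
have hb j k : j != k -> S j k <= 2^-1.
  move=> jk; have := h2 (j, k); rewrite /large_dot /= (negPf jk) /= => /negP.
  rewrite -ltNge => h.
  by rewrite SE ler_pdivrMl // ltW.
have posE j : \sum_(k | k != j) Num.max 0 (S j k) = n%:R^-1 * pos_dots X j w.
  rewrite mulr_sumr; apply: eq_bigr => k _; rewrite SE.
  by rewrite maxr_pMr ?mulr0 ?invr_ge0 ?(ltW nR).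
have pos_lb j : p.-1%:R / 100 * (4 / 5 * r) <= pos_dots X j w.
  have qj : 0 < col_sqr X j w by apply: lt_trans (q1 j); rewrite mulr_gt0 // divr_gt0.
  have sq0 : 0 < Num.sqrt (col_sqr X j w) by rewrite sqrtr_gt0.
  have : p.-1%:R / 100 < pos_dots X j w * col_sqr X j w `^ (- 2^-1).
    by rewrite ltNge; apply/negP => h; exact: (h3 j).
  rewrite powRN powR12_sqrt ?(ltW qj) // ltr_pdivlMr // => /ltW; apply: le_trans.
  rewrite ler_wpM2l //.
  rewrite -(ler_pXn2r (n := 2)) ?nnegrE ?mulr_ge0 ?(ltW r0) ?(ltW sq0) //.
  rewrite sqr_sqrtr ?(ltW qj) // exprMn [r ^+ 2]expr2 r2; have := q1 j; lra.
have trS : p%:R * (1 - eta) <= \sum_j S j j.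
  have /negP := h4; rewrite -ltNge => h.
  rewrite (eq_bigr (fun j => n%:R^-1 * col_sqr X j w)) // -mulr_sumr.
  rewrite ler_pdivlMl // mulrA -natrM (le_trans (ltW h)) //.
  rewrite big_enum /= le_eqVlt; apply/orP; left; apply/eqP.
  by rewrite /col_sqr exchange_big pair_bigA.
apply: le_trans (lambda_max_Sigma_hat_lower (ltnW p1) (sample_cov_sym w) _ ha hb); last lra.
rewrite ler_pdivlMr ?ltr0n ?(ltnW p1) // big_split /=.
under [X in _ <= _ + X]eq_bigr do rewrite posE.
apply: (@le_trans _ _ (p%:R * (1 - eta) +
    \sum_(j < p) n%:R^-1 * (p.-1%:R / 100 * (4 / 5 * r)))).
  rewrite sumr_const card_ord -mulr_natl mulrC -subr_ge0 -[leRHS]/(_ - _).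
  have pE : p.-1%:R = p%:R - 1 :> R by rewrite -subn1 natrB // ltnW.
  have -> : n%:R^-1 * (p.-1%:R / 100 * (4 / 5 * r)) = (p%:R - 1) / r / 125.
    by rewrite pE -r2; field; rewrite gt_eqF.
  (* The gain must cover [2 eta], once for the loss in the trace and once for the claim:
     [(p - 1) / 125 >= p / 250] by [p >= 2]. *)
  rewrite (_ : _ - _ = p%:R * ((p%:R - 1) / r / 125 - 2 * eta)); last by ring.
  rewrite mulr_ge0 // (_ : _ - _ = (p%:R / 250 - 125^-1) / r +
      (p%:R / 250 - 250^-1 * p%:R) / r).
    by apply: addr_ge0; (apply: divr_ge0; [lra|exact: ltW]).
  by rewrite /eta; field; rewrite gt_eqF.
by apply: lerD trS _; apply: ler_sum => j _; rewrite ler_wpM2l // invr_ge0 ltW.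
Qed.

Lemma measurable_short_col j : measurable (short_col j).
Proof.
by apply: measurable_set_ler => //; apply: measurable_sum => k; apply: measurable_funX.
Qed.

Lemma measurable_large_dot jk : measurable (large_dot jk).
Proof.
rewrite /large_dot; case: ifP => // _; apply: measurable_set_ler => //.
by apply: measurable_sum => i; apply: measurable_funM.
Qed.

Lemma measurable_small_trace eta : measurable (small_trace eta).
Proof.
by apply: measurable_set_ler => //; apply: measurable_sum => k; apply: measurable_funX.
Qed.

Hypothesis iidX : iid_std_gaussian_rows X.

Lemma short_col_tail j : (P (short_col j) <= (expR (- (n%:R / 128)))%:E)%E.
Proof.
have := chi2_lower_tail iidX (eta := 4^-1) (col_seq_uniq n j).
rewrite size_col_seq => h; apply: le_trans (h _) _ => //.
by rewrite lee_fin ler_expR lerN2; lra.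
Qed.

Lemma large_dot_tail jk : (P (large_dot jk) <= (expR (- (n%:R / 12)))%:E)%E.
Proof.
rewrite /large_dot; case: eqP => [_|/eqP jk0]; last exact: inner_product_tail.
by rewrite measure0 lee_fin expR_ge0.
Qed.

Lemma small_trace_tail (eta : R) : 0 <= eta ->
  (P (small_trace eta) <= (expR (- ((n * p)%:R * eta ^+ 2 / 8)))%:E)%E.
Proof.
move=> eta0; have := chi2_lower_tail iidX (enum_uniq {: 'I_n * 'I_p}) eta0.
by rewrite -cardE card_prod !card_ord.
Qed.

(** With [u = p e < 1/3], the four bad events have probabilities at most [u e], [e], [u^2] and
    [u e]: the tails over columns and pairs are below [e^2], which absorbs the factors [p] and [p^2]
    of the union bounds. *)
Lemma good_event_prob (e : R) : (0 < n)%N -> (17 <= p)%N ->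
  e = expR (- (500^-1 * 500^-1 * (minn n p)%:R)) -> 3 * p%:R * e < 1 ->
  prob_at_least P
    [set w | 1 + 500^-1 * (p%:R / Num.sqrt n%:R)
             <= lambda_max (Sigma_hat (sample_cov (data_matrix X w)))]
    (1 - 3 * p%:R * e).
Proof.
move=> n0 p17 eE small; have e0 : 0 < e by rewrite eE expR_gt0.
have nR : 0 < n%:R :> R by rewrite ltr0n.
have pR : 17 <= p%:R :> R by rewrite (ler_nat R 17).
pose eta : R := 500^-1 * (p%:R / Num.sqrt n%:R).
have eta0 : 0 <= eta.
  by apply: mulr_ge0; [lra|apply: divr_ge0; [exact: ler0n|exact: sqrtr_ge0]].
have qn : (minn n p)%:R <= n%:R :> R by rewrite ler_nat geq_minl.
have qp : (minn n p)%:R <= p%:R :> R by rewrite ler_nat geq_minr.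
pose U1 := [set w | exists2 j, j \in enum 'I_p & short_col j w].
pose U2 := small_trace eta.
pose U3 := [set w | exists2 jk, jk \in enum {: 'I_p * 'I_p} & large_dot jk w].
pose U4 := [set w | exists2 j, j \in enum 'I_p & few_pos_dots X j w].
have mU1 : measurable U1 by apply: measurable_seq_bigcup; exact: measurable_short_col.
have mU2 : measurable U2 by exact: measurable_small_trace.
have mU3 : measurable U3 by apply: measurable_seq_bigcup; exact: measurable_large_dot.
have mU4 : measurable U4 by apply: measurable_seq_bigcup; exact: measurable_few_pos_dots.
pose U := (U1 `|` U2) `|` (U3 `|` U4).
have mU : measurable U by apply: measurableU; exact: measurableU.
exists (~` U); split; first exact: measurableC.
  move=> w /= nU; apply: lambda_max_good => //.
  - exact: leq_trans p17.
  - by move=> j hj; apply: nU; left; left; exists j; rewrite ?mem_enum.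
  - by move=> jk hj; apply: nU; right; left; exists jk; rewrite ?mem_enum.
  - by move=> j hj; apply: nU; right; right; exists j; rewrite ?mem_enum.
  - by move=> h; apply: nU; left; right.
have e2 : expR (- (2 * (500^-1 * 500^-1) * (minn n p)%:R)) = e * e.
  by rewrite eE -expRD; congr expR; lra.
have P1 : (P U1 <= (p%:R * (e * e))%:E)%E.
  have := union_bound (enum 'I_p) measurable_short_col short_col_tail.
  rewrite size_enum_ord => /le_trans; apply; rewrite lee_fin ler_wpM2l //.
  by rewrite -e2 ler_expR; lra.
have P2 : (P U2 <= e%:E)%E.
  apply: le_trans (small_trace_tail eta0) _; rewrite lee_fin eE ler_expR lerN2.
  have -> : (n * p)%:R * eta ^+ 2 / 8 = 500^-1 * 500^-1 * 8^-1 * (p%:R * (p%:R * p%:R)).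
    rewrite /eta natrM exprMn expr_div_n sqr_sqrtr ?(ltW nR) //; field.
    by rewrite gt_eqF.
  (* The trace exponent is [p^3 / (8 * 500^2)], which exceeds [p / 500^2] as [17^2 > 8]. *)
  have : 17 * 17 * p%:R <= p%:R * (p%:R * p%:R) :> R.
    rewrite [leRHS]mulrC ler_wpM2r // ler_pM //.
  lra.
have P3 : (P U3 <= ((p%:R * e) * (p%:R * e))%:E)%E.
  have := union_bound (enum {: 'I_p * 'I_p}) measurable_large_dot large_dot_tail.
  rewrite -cardE card_prod !card_ord => /le_trans; apply; rewrite lee_fin.
  rewrite natrM mulrACA ler_wpM2l ?mulr_ge0 //.
  by rewrite -e2 ler_expR; lra.
have P4 : (P U4 <= (p%:R * (e * e))%:E)%E.
  have := union_bound (enum 'I_p) (measurable_few_pos_dots X) (few_pos_dots_tail iidX).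
  rewrite size_enum_ord => /le_trans; apply; rewrite lee_fin ler_wpM2l //.
  rewrite -e2 ler_expR -subn1 natrB; last exact: leq_trans p17.
  by lra.
have PU : (P U <= (3 * p%:R * e)%:E)%E.
  apply: (@le_trans _ _ ((p%:R * (e * e))%:E + e%:E +
      (((p%:R * e) * (p%:R * e))%:E + (p%:R * (e * e))%:E))%E).
    apply: le_trans (measureU2 _ _ _) _ => //; [exact: measurableU|exact: measurableU|].
    apply: leeD.
      by apply: le_trans (measureU2 _ _ _) _ => //; exact: leeD.
    by apply: le_trans (measureU2 _ _ _) _ => //; exact: leeD.
  rewrite -!EFinD lee_fin -[leRHS]mulrA.
  move: small; rewrite -mulrA; set u := p%:R * e => small.
  have u0 : 0 < u by rewrite mulr_gt0 // (lt_le_trans _ pR).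
  have ue : 17 * e <= u by rewrite ler_wpM2r // ltW.
  have uu : u * u <= u * 3^-1 by rewrite ler_wpM2l ?(ltW u0) //; lra.
  have ee : p%:R * (e * e) <= u * 3^-1.
    by rewrite mulrA ler_wpM2l ?(ltW u0) //; lra.
  lra.
rewrite probability_setC // EFinB; apply: leeB => //.
Qed.
End good_event.
End main.


Theorem theorem5 (R : realType) :
  exists c1 c2 : R, [/\ 0 < c1, 0 < c2 &
    forall (n p : nat), (2 <= n)%N -> (17 <= p)%N ->
    forall (d : measure_display) (T : measurableType d) (P : probability T R)
           (X : 'I_n -> {RV P >-> p.-tuple R}),
      iid_std_gaussian_rows X ->
      prob_at_least P
        [set w | 1 + c1 * (p%:R / Num.sqrt n%:R)
                 <= lambda_max (Sigma_hat (sample_cov (data_matrix X w)))]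
        (1 - 3%:R * p%:R * expR (- c2 * (minn n p)%:R))].
Proof.
exists 500^-1, (500^-1 * 500^-1); split; [lra|lra|] => n p n2 p17 d T P X iidX.
have [triv|small] := leP 1 (3%:R * p%:R * expR (- (500^-1 * 500^-1) * (minn n p)%:R) : R).
  (* The required probability is nonpositive here, and the empty event serves. *)
  exists set0; split=> //; rewrite measure0 lee_fin; lra.
apply: good_event_prob => //; [exact: ltnW|by rewrite mulNr].
Qed.
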